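(* Let $\mathbf k$ be a field of characteristic zero, let $\rho:Q\to R$ be a weak equivalence of modular operads in complexes of $\mathbf k$-vector spaces, and let $M$ be a minimal modular operad. For every morphism of modular operads $\psi:M\to R$ there exists a morphism of modular operads $\widetilde\psi:M\to Q$ such that $\rho\widetilde\psi$ is homotopic to $\psi$. Moreover, $\widetilde\psi$ is unique up to homotopy.
   Context: Complexes have differential of degree $-1$, with Koszul signs. A modular $\Sigma$-module is a family $E((g,l))$, $g,l\ge0$, $2g-2+l>0$, of complexes with right $\Sigma_l$-actions. A (dg) modular operad (Getzler–Kapranov) is a modular $\Sigma$-module $P$ with compositions $\circ_i:P((g,l))\otimes P((h,m))\to P((g+h,l+m-2))$, $1\le i\le l$, and contractions $\xi_{ij}:P((g,l))\to P((g+1,l-2))$, $i\ne j$, satisfying the usual axioms of associativity, commutativity, equivariance and compatibility (no units). A weak equivalence is a morphism that is a homology isomorphism for every $(g,l)$. Homotopy. Let $\mathbf I=\mathbf k[t,\delta t]$ be the differential graded commutative algebra generated by $t$ in degree $0$ and its differential $\delta t$ in degree $-1$. For a modular operad $P$, $P\otimes\mathbf I$ is the modular operad obtained by extension of scalars, with evaluations $\rho_0,\rho_1:P\otimes\mathbf I\to P$ at $t=0,1$. An elementary homotopy between $f_0,f_1:P\to Q$ is a morphism of modular operads $h:P\to Q\otimes\mathbf I$ with $\rho_ih=f_i$, $i=0,1$. Homotopy is the equivalence relation generated by elementary homotopy. Minimality. The modular dimension is $d(g,l)=3g-3+l$, and $E_n=(E((g,l)))_{d(g,l)=n}$. An $n$-truncated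 modular operad is one defined only for $d(g,l)\le n$, with the operations and axioms that make sense; $t_n$ is truncation, $t_!$ its left adjoint. The canonical tower of $P$ is $0\to t_!t_0P\to\cdots\to t_!t_{n-1}P\to t_!t_nP\to\cdots$. For a modular operad $P$, a modular $\Sigma$-module $V$ with zero differential concentrated in modular dimension $n$, and a chain map $\xi:V[-1]\to P_n$ (where $V[-1]_i=V_{i+1}$), the principal extension $P\sqcup_\xi V$ represents the functor sending $Q$ to the set of pairs $(f,g)$, $f:P\to Q$ a morphism of modular operads and $g:V\to Q$ a degree $0$ homogeneous equivariant map with $d_Qg=f\xi$. $M$ is minimal if each step $t_!t_{n-1}M\to t_!t_nM$ ($n\ge0$, $t_!t_{-1}M=0$) is such a principal extension with $V$ in modular dimension $n$. *)

(* Defs.v *)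
From HB Require Import structures.
From mathcomp Require Import all_boot all_order all_fingroup all_algebra.
From mathcomp Require Import boolp classical_sets functions cardinality fsbigop.
From mathcomp Require Import ring zify.
From Stdlib Require Import Relation_Operators.

Set Implicit Arguments.
Unset Strict Implicit.
Unset Printing Implicit Defensive.

Import Order.TTheory GRing.Theory Num.Theory.
Local Open Scope ring_scope.

(* A complex is given by its total space, the direct sum of its homogeneous   *)
(* components; [cx_pr i] is the projection onto the component of degree [i].  *)
(* Working with total spaces, a degree 0 map out of a tensor product is a     *)
(* bilinear map of total spaces which is additive on degrees.                 *)
Record complex (k : fieldType) := Complex {
  cx_sort :> lmodType k;
  cx_pr : int -> {linear cx_sort -> cx_sort};
  cx_d : {linear cx_sort -> cx_sort};
  cx_prK : forall i j x, cx_pr i (cx_pr j x) = if i == j then cx_pr j x else 0;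
  cx_fin : forall x, exists2 s : seq int,
    uniq s & x = \sum_(i <- s) cx_pr i x;
  cx_prd : forall i x, cx_pr i (cx_d x) = cx_d (cx_pr (i + 1) x);
  cx_dd : forall x, cx_d (cx_d x) = 0
}.

Definition homog (k : fieldType) (C : complex k) (i : int) (x : C) : Prop :=
  cx_pr C i x = x.

Definition gsign (k : fieldType) (C : complex k) (x : C) : C :=
  \sum_(i \in [set: int]) ((-1) ^ i : k) *: cx_pr C i x.

Definition cycle (k : fieldType) (C : complex k) (i : int) (x : C) : Prop :=
  homog i x /\ cx_d C x = 0.

Definition homologous (k : fieldType) (C : complex k) (i : int) (x y : C) :
    Prop :=
  exists2 z : C, homog (i + 1) z & x - y = cx_d C z.

(* The map induced on the quotient of the [i]-cycles by [homologous i] is     *)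
(* injective and surjective, for every [i].                                   *)
Definition homology_iso (k : fieldType) (C D : complex k)
    (f : {linear C -> D}) : Prop :=
  forall i : int,
    (forall x y : C, cycle i x -> cycle i y ->
       homologous i (f x) (f y) -> homologous i x y) /\
    (forall y : D, cycle i y -> exists2 x : C, cycle i x & homologous i (f x) y).


Record mtype := Mtype {
  genus : nat;
  legs : nat;
  mtype_stable : (2 < 2 * genus + legs)%N
}.

Definition dim (u : mtype) : int := 3 * (genus u)%:Z - 3 + (legs u)%:Z.

Record idx (D : pred mtype) := Idx { idx_val :> mtype; idx_in : D idx_val }.

(* The underlying pair of [full u] is convertible to that of [u], so that     *)
(* restricting families along [full] involves no transport.                   *)
Definition full (D : pred mtype) (u : idx D) : idx predT :=
  @Idx predT u isT.

Definition dim_le (n : int) : pred mtype := [pred u | dim u <= n].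

(* The target of an operation is any [w] of the right genus and number of     *)
(* legs: this avoids transports along arithmetic identities when operations   *)
(* are iterated.                                                              *)
Definition glue (u v w : mtype) : bool :=
  [&& genus w == (genus u + genus v)%N, (legs w).+2 == (legs u + legs v)%N
    & (0 < legs v)%N].

Definition selfglue (u w : mtype) : bool :=
  (genus w == (genus u).+1) && ((legs w).+2 == legs u).

(* Legs are numbered from 0. In [a o_i b] the leg [i] of [a] is glued to the  *)
(* leg 0 of [b], and the legs are then ordered as follows: the legs of [a]    *)
(* before [i], the legs of [b] other than 0, the legs of [a] after [i].       *)
(* [gluel m i k] is the place of the leg [k != i] of [a], when [b] has [m]    *)
(* legs, and [gluer i k] the place of the leg [k != 0] of [b]. Contraction    *)
(* keeps the order of the remaining legs: [selfpos i j k] is the place of     *)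
(* the leg [k] after the contraction of [i] and [j].                          *)
Definition gluel (m i k : nat) : nat :=
  if (k < i)%N then k else (k.-1 + m.-1)%N.
Definition gluer (i k : nat) : nat := (i + k.-1)%N.
Definition selfpos (i j k : nat) : nat := (k - (i < k) - (j < k))%N.

(* Permutations act on the right with respect to composition of functions:    *)
(* the leg [k] of [x s] is the leg [s k] of [x], and [(x s) t = x (s \o t)].  *)
(* As [(t * s)%g] is [s \o t], this is the form of [sm_actM].                 *)
Record smod (k : fieldType) (D : pred mtype) := Smod {
  sm_cx :> idx D -> complex k;
  sm_act : forall u : idx D, 'S_(legs u) -> {linear sm_cx u -> sm_cx u};
  sm_act_pr : forall (u : idx D) (s : 'S_(legs u)) i x,
    sm_act s (cx_pr _ i x) = cx_pr _ i (sm_act s x);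
  sm_act_d : forall (u : idx D) (s : 'S_(legs u)) x,
    sm_act s (cx_d _ x) = cx_d _ (sm_act s x);
  sm_act1 : forall u x, @sm_act u 1%g x = x;
  sm_actM : forall (u : idx D) (s t : 'S_(legs u)) x,
    sm_act (t * s)%g x = sm_act t (sm_act s x)
}.
Arguments sm_act {k D} _ {u} _.

(* [modop k predT] is the type of modular operads, [modop k (dim_le n)] that  *)
(* of n-truncated ones. In the axioms the places of legs, and the relabelling *)
(* permutations, are determined by their values. Gluings and contractions     *)
(* involving other legs of the second factor follow from [op_compC] and       *)
(* equivariance.                                                              *)
Record modop (k : fieldType) (D : pred mtype) := Modop {
  op_smod :> smod k D;
  op_comp : forall u v w : idx D, glue u v w -> 'I_(legs u) ->
    op_smod u -> op_smod v -> op_smod w;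
  op_contr : forall (u w : idx D) (i j : 'I_(legs u)), i != j -> selfglue u w ->
    {linear op_smod u -> op_smod w};

  op_compl : forall (u v w : idx D) (e : glue u v w) i (b : op_smod v),
    linear (fun a : op_smod u => op_comp e i a b);
  op_compr : forall (u v w : idx D) (e : glue u v w) i (a : op_smod u),
    linear (op_comp e i a);
  op_comp_homog : forall (u v w : idx D) (e : glue u v w) i (p q : int)
      (a : op_smod u) (b : op_smod v),
    homog p a -> homog q b -> homog (p + q) (op_comp e i a b);
  op_comp_d : forall (u v w : idx D) (e : glue u v w) i (p : int)
      (a : op_smod u) (b : op_smod v), homog p a ->
    cx_d _ (op_comp e i a b) =
      op_comp e i (cx_d _ a) b + ((-1) ^ p : k) *: op_comp e i a (cx_d _ b);
  op_contr_pr : forall (u w : idx D) (i j : 'I_(legs u)) (ij : i != j)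
      (e : selfglue u w) (p : int) a,
    op_contr ij e (cx_pr _ p a) = cx_pr _ p (op_contr ij e a);
  op_contr_d : forall (u w : idx D) (i j : 'I_(legs u)) (ij : i != j)
      (e : selfglue u w) a,
    op_contr ij e (cx_d _ a) = cx_d _ (op_contr ij e a);

  op_comp_act : forall (u v w : idx D) (e : glue u v w) (i : 'I_(legs u))
      (s : 'S_(legs u)) (t : 'S_(legs v)) (r : 'S_(legs w))
      (a : op_smod u) (b : op_smod v),
    (forall z : 'I_(legs v), z = 0 :> nat -> t z = z) ->
    (forall (x : 'I_(legs w)) (y : 'I_(legs u)), y != i ->
       x = gluel (legs v) i y :> nat ->
       r x = gluel (legs v) (s i) (s y) :> nat) ->
    (forall (x : 'I_(legs w)) (y : 'I_(legs v)), (0 < y)%N ->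
       x = gluer i y :> nat -> r x = gluer (s i) (t y) :> nat) ->
    op_comp e i (sm_act _ s a) (sm_act _ t b) =
      sm_act _ r (op_comp e (s i) a b);
  op_contr_act : forall (u w : idx D) (e : selfglue u w)
      (s : 'S_(legs u)) (i j : 'I_(legs u)) (ij : i != j) (sij : s i != s j)
      (r : 'S_(legs w)) (a : op_smod u),
    (forall (x : 'I_(legs w)) (y : 'I_(legs u)), y != i -> y != j ->
       x = selfpos i j y :> nat -> r x = selfpos (s i) (s j) (s y) :> nat) ->
    op_contr ij e (sm_act _ s a) = sm_act _ r (op_contr sij e a);

  op_compC : forall (u v w : idx D) (e : glue u v w) (e' : glue v u w)
      (i : 'I_(legs u)) (j : 'I_(legs v)) (r : 'S_(legs w)) (p q : int)
      (a : op_smod u) (b : op_smod v),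
    i = 0 :> nat -> j = 0 :> nat ->
    (forall (x : 'I_(legs w)) (y : 'I_(legs u)), (0 < y)%N ->
       x = gluel (legs v) i y :> nat -> r x = gluer j y :> nat) ->
    (forall (x : 'I_(legs w)) (y : 'I_(legs v)), (0 < y)%N ->
       x = gluer i y :> nat -> r x = gluel (legs u) j y :> nat) ->
    homog p a -> homog q b ->
    op_comp e i a b =
      ((-1) ^ (p * q) : k) *: sm_act _ r (op_comp e' j b a);

  op_compA : forall (u v w uv vw z : idx D)
      (e1 : glue u v uv) (e2 : glue uv w z) (e3 : glue v w vw)
      (e4 : glue u vw z) (i : 'I_(legs u)) (j : 'I_(legs v))
      (j' : 'I_(legs uv)) (a : op_smod u) (b : op_smod v) (c : op_smod w),
    (0 < j)%N -> j' = gluer i j :> nat ->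
    op_comp e2 j' (op_comp e1 i a b) c = op_comp e4 i a (op_comp e3 j b c);
  op_compAC : forall (u v w uv uw z : idx D)
      (e1 : glue u v uv) (e2 : glue uv w z) (e3 : glue u w uw)
      (e4 : glue uw v z) (i j : 'I_(legs u))
      (j' : 'I_(legs uv)) (i' : 'I_(legs uw)) (p q : int)
      (a : op_smod u) (b : op_smod v) (c : op_smod w),
    i != j -> j' = gluel (legs v) i j :> nat ->
    i' = gluel (legs w) j i :> nat ->
    homog p b -> homog q c ->
    op_comp e2 j' (op_comp e1 i a b) c =
      ((-1) ^ (p * q) : k) *: op_comp e4 i' (op_comp e3 j a c) b;

  op_contr_sym : forall (u w : idx D) (e : selfglue u w) (i j : 'I_(legs u))
      (ij : i != j) (ji : j != i) (a : op_smod u),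
    op_contr ij e a = op_contr ji e a;
  op_contrAC : forall (u v v' w : idx D) (e1 : selfglue u v)
      (e2 : selfglue v w) (e3 : selfglue u v') (e4 : selfglue v' w)
      (i j l m : 'I_(legs u)) (l' m' : 'I_(legs v)) (i' j' : 'I_(legs v'))
      (ij : i != j) (lm : l != m) (lm' : l' != m') (ij' : i' != j')
      (a : op_smod u),
    uniq [:: i; j; l; m] ->
    l' = selfpos i j l :> nat -> m' = selfpos i j m :> nat ->
    i' = selfpos l m i :> nat -> j' = selfpos l m j :> nat ->
    op_contr lm' e2 (op_contr ij e1 a) = op_contr ij' e4 (op_contr lm e3 a);
  op_contr_comp : forall (u v uv u' w : idx D) (e1 : glue u v uv)
      (e2 : selfglue uv w) (e3 : selfglue u u') (e4 : glue u' v w)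
      (l i j : 'I_(legs u)) (i' j' : 'I_(legs uv)) (l' : 'I_(legs u'))
      (ij : i != j) (ij' : i' != j') (a : op_smod u) (b : op_smod v),
    i != l -> j != l ->
    i' = gluel (legs v) l i :> nat -> j' = gluel (legs v) l j :> nat ->
    l' = selfpos i j l :> nat ->
    op_contr ij' e2 (op_comp e1 l a b) = op_comp e4 l' (op_contr ij e3 a) b;
  (* Two edges between [a] and [b], joining [l] to [z] (the leg 0 of [b]) and *)
  (* [i] to [j]: they can be glued in either order. The leg 0 of [b (z j)] is *)
  (* the leg [j] of [b], and its leg [j] is the leg 0 of [b].                 *)
  op_contr_comp2 : forall (u v uv w : idx D) (e1 : glue u v uv)
      (e2 : selfglue uv w) (l i : 'I_(legs u)) (z j : 'I_(legs v))
      (i1 j1 l2 j2 : 'I_(legs uv)) (ij : i1 != j1) (lj : l2 != j2)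
      (r : 'S_(legs w)) (a : op_smod u) (b : op_smod v),
    z = 0 :> nat -> (0 < j)%N -> i != l ->
    i1 = gluel (legs v) l i :> nat -> j1 = gluer l j :> nat ->
    l2 = gluel (legs v) i l :> nat -> j2 = gluer i j :> nat ->
    (forall (x : 'I_(legs w)) (y : 'I_(legs u)), y != i -> y != l ->
       x = selfpos i1 j1 (gluel (legs v) l y) :> nat ->
       r x = selfpos l2 j2 (gluel (legs v) i y) :> nat) ->
    (forall (x : 'I_(legs w)) (y : 'I_(legs v)), y != z -> y != j ->
       x = selfpos i1 j1 (gluer l y) :> nat ->
       r x = selfpos l2 j2 (gluer i y) :> nat) ->
    op_contr ij e2 (op_comp e1 l a b) =
      sm_act _ r (op_contr lj e2 (op_comp e1 i a (sm_act _ (tperm z j) b)))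
}.
Arguments op_comp {k D} _ {u v w} _ _ _ _.
Arguments op_contr {k D} _ {u w i j} _ _.

Record mor (k : fieldType) (D : pred mtype) (P Q : modop k D) := Mor {
  mor_fun :> forall u : idx D, {linear P u -> Q u};
  mor_pr : forall u i x, mor_fun u (cx_pr _ i x) = cx_pr _ i (mor_fun u x);
  mor_d : forall u x, mor_fun u (cx_d _ x) = cx_d _ (mor_fun u x);
  mor_act : forall (u : idx D) (s : 'S_(legs u)) x,
    mor_fun u (sm_act P s x) = sm_act Q s (mor_fun u x);
  mor_op_comp : forall (u v w : idx D) (e : glue u v w) i a b,
    mor_fun w (op_comp P e i a b) = op_comp Q e i (mor_fun u a) (mor_fun v b);
  mor_op_contr : forall (u w : idx D) (i j : 'I_(legs u)) (ij : i != j)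
      (e : selfglue u w) a,
    mor_fun w (op_contr P ij e a) = op_contr Q ij e (mor_fun u a)
}.

Definition eqmor (k : fieldType) (D : pred mtype) (P Q : modop k D)
    (f g : mor P Q) : Prop := forall u, f u =1 g u.

Definition mor_comp (k : fieldType) (D : pred mtype) (P Q R : modop k D)
    (g : mor Q R) (f : mor P Q) : mor P R.
Proof.
refine (@Mor _ _ _ _ (fun u => (g u \o f u : {linear _ -> _})) _ _ _ _ _).
- by move=> u i x /=; rewrite !mor_pr.
- by move=> u x /=; rewrite !mor_d.
- by move=> u s x /=; rewrite !mor_act.
- by move=> u v w e i a b /=; rewrite !mor_op_comp.
- by move=> u w i j ij e a /=; rewrite !mor_op_contr.
Defined.

Definition weak_equivalence (k : fieldType) (D : pred mtype) (P Q : modop k D)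
  (f : mor P Q) : Prop := forall u, homology_iso (f u).


Section VPoly.
Variables (k : fieldType).

Definition vfin (V : lmodType k) : {pred nat -> V} :=
  [pred p | `[< exists N, forall n, (N <= n)%N -> p n = 0 >]].
Arguments vfin V : clear implicits.

Lemma vfinP (V : lmodType k) (p : nat -> V) :
  reflect (exists N, forall n, (N <= n)%N -> p n = 0) (p \in vfin V).
Proof. exact: asboolP. Qed.

Lemma vfin_submod (V : lmodType k) : submod_closed (vfin V).
Proof.
split=> [|c p q /vfinP[N pN] /vfinP[M qM]]; apply/vfinP; first by exists 0%N.
exists (maxn N M) => n; rewrite geq_max => /andP[Nn Mn].
by rewrite /GRing.add /= /GRing.scale /= pN // qM // scaler0 addr0.
Qed.

HB.instance Definition _ (V : lmodType k) :=
  GRing.isSubmodClosed.Build k (nat -> V) (vfin V) (vfin_submod V).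

(* Polynomials in one variable with coefficients in [V].                      *)
Record vpoly (V : lmodType k) := VPoly {
  vcoef :> nat -> V;
  vcoef_fin : vcoef \in vfin V
}.

HB.instance Definition _ (V : lmodType k) := [isSub for @vcoef V].
HB.instance Definition _ (V : lmodType k) := [Choice of vpoly V by <:].
HB.instance Definition _ (V : lmodType k) :=
  [SubChoice_isSubLmodule of vpoly V by <:].

Lemma vpolyP (V : lmodType k) (p q : vpoly V) : p =1 q <-> p = q.
Proof.
split=> [pq|-> //]; apply/val_inj/funext; exact: pq.
Qed.

Lemma vcoefD (V : lmodType k) (p q : vpoly V) n : (p + q) n = p n + q n.
Proof. by []. Qed.
Lemma vcoefZ (V : lmodType k) c (p : vpoly V) n : (c *: p) n = c *: p n.
Proof. by []. Qed.
Lemma vcoef0 (V : lmodType k) n : (0 : vpoly V) n = 0.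
Proof. by []. Qed.
Lemma vcoef_sum (V : lmodType k) I (r : seq I) (P : pred I)
  (F : I -> vpoly V) n : (\sum_(i <- r | P i) F i) n = \sum_(i <- r | P i) F i n.
Proof. by elim/big_rec2: _ => // i x y _ <-. Qed.

Lemma vmono_fin (V : lmodType k) a (v : V) :
  (fun n => if n == a then v else 0) \in vfin V.
Proof.
by apply/vfinP; exists a.+1 => n an; case: eqP an => // ->; rewrite ltnn.
Qed.
(* [v t^a] *)
Definition vmono (V : lmodType k) a (v : V) : vpoly V := VPoly (vmono_fin a v).

Lemma vmono_linear (V : lmodType k) a : linear (@vmono V a).
Proof.
move=> c v w; apply/vpolyP => n; rewrite vcoefD vcoefZ /=.
by case: eqP; rewrite ?scaler0 ?addr0.
Qed.
HB.instance Definition _ (V : lmodType k) a :=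
  GRing.isLinear.Build k V (vpoly V) _ (@vmono V a) (@vmono_linear V a).

Lemma vpolyE (V : lmodType k) (p : vpoly V) :
  exists N, p = \sum_(n < N) vmono n (p n).
Proof.
case: p => p pf; have /vfinP[N pN] := pf; exists N; apply/vpolyP => n /=.
rewrite vcoef_sum /=; case: (ltnP n N) => nN; last first.
  rewrite pN // big1 // => i _; case: eqP => // ni.
  by move: (ltn_ord i); rewrite -ni ltnNge nN.
rewrite (bigD1 (Ordinal nN)) //= eqxx big1 ?addr0 // => i /eqP iN.
by case: eqP => // ni; case: iN; apply/val_inj.
Qed.

Lemma vmap_fin (V W : lmodType k) (f : {linear V -> W}) (p : vpoly V) :
  (fun n => f (p n)) \in vfin W.
Proof.
have /vfinP[N pN] := vcoef_fin p.
by apply/vfinP; exists N => n /pN ->; rewrite raddf0.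
Qed.
Definition vmap (V W : lmodType k) (f : {linear V -> W}) (p : vpoly V) :
  vpoly W := VPoly (vmap_fin f p).

Lemma vmap_linear (V W : lmodType k) (f : {linear V -> W}) : linear (vmap f).
Proof. by move=> c p q; apply/vpolyP => n; rewrite /= linearP. Qed.
HB.instance Definition _ (V W : lmodType k) (f : {linear V -> W}) :=
  GRing.isLinear.Build k (vpoly V) (vpoly W) _ (vmap f) (vmap_linear f).

Lemma vmap_mono (V W : lmodType k) (f : {linear V -> W}) a v :
  vmap f (vmono a v) = vmono a (f v).
Proof. by apply/vpolyP => n /=; case: eqP; rewrite ?raddf0. Qed.

Lemma vder_fin (V : lmodType k) (p : vpoly V) :
  (fun n => n.+1%:R *: p n.+1) \in vfin V.
Proof.
have /vfinP[N pN] := vcoef_fin p.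
by apply/vfinP; exists N => n Nn; rewrite pN ?scaler0 // ltnW.
Qed.
Definition vder (V : lmodType k) (p : vpoly V) : vpoly V := VPoly (vder_fin p).

Lemma vder_linear (V : lmodType k) : linear (@vder V).
Proof.
move=> c p q; apply/vpolyP => n; rewrite vcoefD vcoefZ /=.
transitivity (n.+1%:R *: (c *: p n.+1 + q n.+1)); first by [].
by rewrite scalerDr !scalerA (mulrC c).
Qed.
HB.instance Definition _ (V : lmodType k) :=
  GRing.isLinear.Build k (vpoly V) (vpoly V) _ (@vder V) (@vder_linear V).

Lemma vder_mono (V : lmodType k) a (v : V) :
  vder (vmono a v) = a%:R *: vmono a.-1 v.
Proof.
apply/vpolyP => n; rewrite vcoefZ /=; case: a => [|a] /=.
  by rewrite scale0r scaler0.
by rewrite eqSS; case: eqP => [->//|]; rewrite !scaler0.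
Qed.

Section Conv.
Variables (U V W : lmodType k) (f : U -> V -> W).
Hypothesis fl : forall b, linear (fun a => f a b).
Hypothesis fr : forall a, linear (f a).

Let fl0 b : f 0 b = 0.
Proof. by have := fl b (-1) 0 0; rewrite !scaler0 scaleN1r addr0 addNr. Qed.
Let fr0 a : f a 0 = 0.
Proof. by have := fr a (-1) 0 0; rewrite !scaler0 scaleN1r addr0 addNr. Qed.

Lemma vconv_fin (p : vpoly U) (q : vpoly V) :
  (fun n => \sum_(i < n.+1) f (p i) (q (n - i)%N)) \in vfin W.
Proof.
have /vfinP[N pN] := vcoef_fin p; have /vfinP[M qM] := vcoef_fin q.
apply/vfinP; exists (N + M)%N => n NMn; rewrite big1 // => i _.
case: (leqP N i) => [/pN -> //|iN]; rewrite qM //; lia.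
Qed.
(* The product of polynomials extending the bilinear map [f].                 *)
Definition vconv (p : vpoly U) (q : vpoly V) : vpoly W :=
  VPoly (vconv_fin p q).

Lemma vconv_linl q : linear (fun p => vconv p q).
Proof.
move=> c p p'; apply/vpolyP => n; rewrite vcoefD vcoefZ /=
   scaler_sumr -big_split /=.
by apply: eq_bigr => i _; rewrite fl.
Qed.
Lemma vconv_linr p : linear (vconv p).
Proof.
move=> c q q'; apply/vpolyP => n; rewrite vcoefD vcoefZ /=
   scaler_sumr -big_split /=.
by apply: eq_bigr => i _; rewrite fr.
Qed.

Lemma vconv_mono a b x y : vconv (vmono a x) (vmono b y) = vmono (a + b) (f x y).
Proof.
apply/vpolyP => n /=; case: (ltnP n a) => an.
  rewrite big1 => [|i _]; first by case: eqP => // ?; lia.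
  case: eqP => // ia; have := ltn_ord i; lia.
have an' : (a < n.+1)%N by [].
rewrite (bigD1 (Ordinal an')) //= eqxx big1 ?addr0 => [|i /eqP ia]; last first.
  by case: eqP => // ia'; case: ia; apply/val_inj.
have -> : (n - a == b)%N = (n == a + b)%N by apply/eqP/eqP; lia.
by case: eqP.
Qed.
End Conv.

Definition vev (V : lmodType k) (c : k) (p : vpoly V) : V :=
  \sum_(n \in [set: nat]) c ^+ n *: p n.

Lemma vevE (V : lmodType k) c (p : vpoly V) N :
  (forall n, (N <= n)%N -> p n = 0) -> vev c p = \sum_(n < N) c ^+ n *: p n.
Proof.
move=> pN; rewrite /vev (@fsbigE _ _ _ _ _ (iota 0 N)) ?iota_uniq //; last first.
  move=> n _; rewrite mem_iota add0n /= => /negP nN.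
  by rewrite pN ?scaler0 // leqNgt; apply/negP.
rewrite (eq_bigl xpredT) => [|i]; last exact: asboolT.
by rewrite -{1}(subn0 N) [LHS](big_mkord xpredT).
Qed.

Lemma vev_linear (V : lmodType k) c : linear (@vev V c).
Proof.
move=> e p q; have /vfinP[N pN] := vcoef_fin p.
have /vfinP[M qM] := vcoef_fin q.
have pN' n : (N + M <= n)%N -> p n = 0 by move=> ?; apply: pN; lia.
have qM' n : (N + M <= n)%N -> q n = 0 by move=> ?; apply: qM; lia.
rewrite (vevE _ pN') (vevE _ qM') (@vevE _ _ _ (N + M)) => [|n nNM].
  rewrite scaler_sumr -big_split; apply: eq_bigr => i _ /=.
  by rewrite scalerDr !scalerA mulrC.
by rewrite vcoefD vcoefZ pN' // qM' // scaler0 addr0.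
Qed.
HB.instance Definition _ (V : lmodType k) c :=
  GRing.isLinear.Build k (vpoly V) V _ (@vev V c) (@vev_linear V c).

Lemma vev_mono (V : lmodType k) c a (v : V) : vev c (vmono a v) = c ^+ a *: v.
Proof.
rewrite (@vevE _ _ _ a.+1) => [|n an] /=; last by case: eqP => // ?; lia.
rewrite big_ord_recr /= eqxx big1 ?add0r // => i _.
by case: eqP => [ia|]; rewrite ?scaler0 //; have := ltn_ord i; lia.
Qed.

Lemma vev_vmap (V W : lmodType k) (f : {linear V -> W}) c (p : vpoly V) :
  vev c (vmap f p) = f (vev c p).
Proof.
have /vfinP[N pN] := vcoef_fin p.
rewrite (vevE _ pN) (@vevE _ _ _ N) => [|n /pN /= ->]; last by rewrite raddf0.
by rewrite raddf_sum; apply: eq_bigr => i _; rewrite /= linearZ.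
Qed.
End VPoly.

Section Grading.
Variables (k : fieldType) (C : complex k).
Implicit Types x y : C.

Lemma homog_pr i x : homog i (cx_pr C i x).
Proof. by rewrite /homog cx_prK eqxx. Qed.

Lemma homog0 i : homog i (0 : C).
Proof. by rewrite /homog raddf0. Qed.

Lemma homogD i x y : homog i x -> homog i y -> homog i (x + y).
Proof. by rewrite /homog raddfD /= => -> ->. Qed.

Lemma homogZ i (c : k) x : homog i x -> homog i (c *: x).
Proof. by rewrite /homog linearZ /= => ->. Qed.

Lemma homog_d i x : homog (i + 1) x -> homog i (cx_d C x).
Proof. by rewrite /homog cx_prd => ->. Qed.

Lemma cx_supp x : exists2 s : seq int, uniq s & forall t : seq int,
  uniq t -> {subset s <= t} -> x = \sum_(i <- t) cx_pr C i x.
Proof.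
have [s us xs] := cx_fin x; exists s => // t ut st.
have x0 j : j \notin s -> cx_pr C j x = 0.
  move=> js; rewrite xs raddf_sum big1_seq //= => i si.
  by rewrite cx_prK; case: eqP js => // ->; rewrite si.
rewrite {1}xs [RHS](bigID (mem s)) /= [X in _ + X]big1 ?addr0.
  rewrite -[RHS]big_filter; apply/perm_big/uniq_perm; rewrite ?filter_uniq //.
  move=> i; rewrite mem_filter; case si: (i \in s) => //=.
  by rewrite st.
by move=> i si; apply: x0.
Qed.

Lemma gsignE x (s : seq int) : uniq s -> x = \sum_(i <- s) cx_pr C i x ->
  gsign x = \sum_(i <- s) ((-1) ^ i : k) *: cx_pr C i x.
Proof.
move=> us xs.
have x0 j : j \notin s -> cx_pr C j x = 0.
  move=> js; rewrite xs raddf_sum big1_seq //= => i si.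
  by rewrite cx_prK; case: eqP js => // ->; rewrite si.
rewrite /gsign (@fsbigE _ _ _ _ _ s) //; last first.
  by move=> i _ si; rewrite x0 // scaler0.
by apply: eq_bigl => i; apply: asboolT.
Qed.

Lemma gsign_linear : linear (@gsign k C).
Proof.
move=> c x y; have [s _ sx] := cx_supp x; have [t _ ty] := cx_supp y.
pose r := undup (s ++ t).
have rx := sx r (undup_uniq _) _; have ry := ty r (undup_uniq _) _.
rewrite (@gsignE x r) ?undup_uniq //; last first.
  by apply: rx => i si; rewrite mem_undup mem_cat si.
rewrite (@gsignE y r) ?undup_uniq //; last first.
  by apply: ry => i si; rewrite mem_undup mem_cat si orbT.
rewrite (@gsignE _ r) ?undup_uniq //.
  rewrite scaler_sumr -big_split; apply: eq_bigr => i _ /=.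
  by rewrite linearP scalerDr !scalerA mulrC.
rewrite {1}rx => [|i si]; last by rewrite mem_undup mem_cat si.
rewrite {1}ry => [|i si]; last by rewrite mem_undup mem_cat si orbT.
rewrite scaler_sumr -big_split; apply: eq_bigr => i _ /=.
by rewrite linearP.
Qed.
HB.instance Definition _ :=
  GRing.isLinear.Build k C C _ (@gsign k C) gsign_linear.

Lemma gsign_homog i x : homog i x -> gsign x = ((-1) ^ i : k) *: x.
Proof.
by move=> xi; rewrite (@gsignE x [:: i]) // big_seq1 xi.
Qed.

Lemma cx_ind (K : C -> Prop) : K 0 -> (forall x y, K x -> K y -> K (x + y)) ->
  (forall i x, homog i x -> K x) -> forall x, K x.
Proof.
move=> K0 KD Kh x; have [s _ ->] := cx_fin x.
elim/big_ind: _ => // i _; exact: Kh (homog_pr i x).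
Qed.

Lemma signD (i j : int) : (-1 : k) ^ (i + j) = (-1) ^ i * (-1) ^ j.
Proof. by rewrite expfzDr // oppr_eq0 oner_eq0. Qed.

Lemma gsign_pr i x : gsign (cx_pr C i x) = cx_pr C i (gsign x).
Proof.
elim/cx_ind: x => [|x y xE yE|j x xj]; first by rewrite !raddf0.
  by rewrite !raddfD /= xE yE.
rewrite (gsign_homog xj) linearZ /=.
have := cx_prK i j x; rewrite xj => ->; case: eqP => _.
  by rewrite (gsign_homog xj).
by rewrite raddf0 scaler0.
Qed.

Lemma gsign_d x : gsign (cx_d C x) = - cx_d C (gsign x).
Proof.
elim/cx_ind: x => [|x y xE yE|j x xj].
- by rewrite (raddf0 (cx_d C)) (raddf0 (@gsign k C)) raddf0 oppr0.
- by rewrite !raddfD /= xE yE.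
rewrite (gsign_homog xj) linearZ /= (@gsign_homog (j - 1)).
  by rewrite signD exprN1 invrN1 mulrN1 scaleNr.
by apply: homog_d; rewrite subrK.
Qed.

Lemma gsignK x : gsign (gsign x) = x.
Proof.
elim/cx_ind: x => [|x y xE yE|j x xj]; first by rewrite !raddf0.
  by rewrite !raddfD /= xE yE.
rewrite (gsign_homog xj) linearZ /= (gsign_homog xj) scalerA -expfzMl.
by rewrite mulrNN mulr1 exp1rz scale1r.
Qed.

End Grading.

(* C (x) k[t, dt] = C[t] (+) C[t] dt, with dt in degree -1: the pair [(p, q)] *)
(* is p + q dt. The sign in the differential comes from                       *)
(* d(v t^n) = (d v) t^n + (-1)^|v| n v t^(n-1) dt.                            *)
Section TensorI.
Variables (k : fieldType) (C : complex k).

Definition tensI_pr (i : int) (x : vpoly C * vpoly C) : vpoly C * vpoly C :=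
  (vmap (cx_pr C i) x.1, vmap (cx_pr C (i + 1)) x.2).
Definition tensI_d (x : vpoly C * vpoly C) : vpoly C * vpoly C :=
  (vmap (cx_d C) x.1, vmap (cx_d C) x.2 + vder (vmap (@gsign k C) x.1)).

Lemma tensI_pr_linear i : linear (tensI_pr i).
Proof. by move=> c x y; rewrite /tensI_pr /= !linearP. Qed.
HB.instance Definition _ i := GRing.isLinear.Build k (vpoly C * vpoly C)%type
  (vpoly C * vpoly C)%type _ (tensI_pr i) (tensI_pr_linear i).

Lemma tensI_d_linear : linear tensI_d.
Proof.
move=> c x y; rewrite /tensI_d /= !linearP; congr (_, _).
by rewrite /= scalerDr addrACA.
Qed.
HB.instance Definition _ := GRing.isLinear.Build k (vpoly C * vpoly C)%type
  (vpoly C * vpoly C)%type _ tensI_d tensI_d_linear.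

Definition mI (a : nat) (v : C) : vpoly C * vpoly C := (vmono a v, 0).
Definition mdI (a : nat) (v : C) : vpoly C * vpoly C := (0, vmono a v).

Lemma mI_linear a : linear (mI a).
Proof.
by move=> c v w; rewrite /mI linearP; congr (_, _); rewrite /= scaler0 addr0.
Qed.
HB.instance Definition _ a :=
  GRing.isLinear.Build k C (vpoly C * vpoly C)%type _ (mI a) (mI_linear a).
Lemma mdI_linear a : linear (mdI a).
Proof.
by move=> c v w; rewrite /mdI linearP; congr (_, _); rewrite /= scaler0 addr0.
Qed.
HB.instance Definition _ a :=
  GRing.isLinear.Build k C (vpoly C * vpoly C)%type _ (mdI a) (mdI_linear a).

Lemma mID a v w : mI a (v + w) = mI a v + mI a w.
Proof. exact: raddfD. Qed.
Lemma mIZ a (c : k) v : mI a (c *: v) = c *: mI a v.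
Proof. exact: linearZ. Qed.
Lemma mdID a v w : mdI a (v + w) = mdI a v + mdI a w.
Proof. exact: raddfD. Qed.
Lemma mdIZ a (c : k) v : mdI a (c *: v) = c *: mdI a v.
Proof. exact: linearZ. Qed.

Lemma tensI_pr_mI i a v : tensI_pr i (mI a v) = mI a (cx_pr C i v).
Proof. by rewrite /tensI_pr /= vmap_mono raddf0. Qed.
Lemma tensI_pr_mdI i a v : tensI_pr i (mdI a v) = mdI a (cx_pr C (i + 1) v).
Proof. by rewrite /tensI_pr /= vmap_mono raddf0. Qed.
Lemma tensI_d_mI a v : tensI_d (mI a v) =
  mI a (cx_d C v) + a%:R *: mdI a.-1 (gsign v).
Proof.
rewrite /tensI_d /= !vmap_mono raddf0 vder_mono /mdI /mI.
by congr (_, _); rewrite /= ?scaler0 ?addr0 ?add0r.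
Qed.
Lemma tensI_d_mdI a v : tensI_d (mdI a v) = mdI a (cx_d C v).
Proof. by rewrite /tensI_d /= vmap_mono !raddf0 addr0. Qed.

Lemma tensI_sum (x : vpoly C * vpoly C) : exists N M,
  x = \sum_(n < N) mI n (x.1 n) + \sum_(n < M) mdI n (x.2 n).
Proof.
case: x => p q /=; have [N pN] := vpolyE p; have [M qM] := vpolyE q.
exists N, M.
have E1 : \sum_(n < N) mI n (p n) = (p, 0).
  rewrite [in RHS]pN; apply: (big_rec2 (fun x y => x = (y, 0))) => [//|i y1 y2 _ ->].
  by congr (_, _); rewrite /= addr0.
have E2 : \sum_(n < M) mdI n (q n) = (0, q).
  rewrite [in RHS]qM; apply: (big_rec2 (fun x y => x = (0, y))) => [//|i y1 y2 _ ->].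
  by congr (_, _); rewrite /= addr0.
by rewrite E1 E2; congr (_, _); rewrite /= ?addr0 ?add0r.
Qed.

Lemma tensI_prK i j x :
  tensI_pr i (tensI_pr j x) = if i == j then tensI_pr j x else 0.
Proof.
case: eqP => [->|ij]; congr (_, _); apply/vpolyP => n /=; rewrite cx_prK.
- by rewrite eqxx.
- by rewrite eqxx.
- by case: eqP.
- by case: eqP => // /addIr.
Qed.

Lemma tensI_fin x : exists2 s : seq int,
  uniq s & x = \sum_(i <- s) tensI_pr i x.
Proof.
suff [s us sP] : exists2 s : seq int, uniq s & forall t : seq int,
    uniq t -> {subset s <= t} -> x = \sum_(i <- t) tensI_pr i x.
  by exists s => //; apply: sP.
have KD y z : (exists2 s : seq int, uniq s & forall t : seq int,
    uniq t -> {subset s <= t} -> y = \sum_(i <- t) tensI_pr i y) ->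
    (exists2 s : seq int, uniq s & forall t : seq int,
    uniq t -> {subset s <= t} -> z = \sum_(i <- t) tensI_pr i z) ->
    (exists2 s : seq int, uniq s & forall t : seq int,
    uniq t -> {subset s <= t} -> y + z = \sum_(i <- t) tensI_pr i (y + z)).
  move=> [s us sP] [s' us' sP']; exists (undup (s ++ s')); first exact: undup_uniq.
  move=> t ut st; rewrite {1}(sP t) // => [|i si]; last first.
    by apply: st; rewrite mem_undup mem_cat si.
  rewrite {1}(sP' t) // => [|i si]; last first.
    by apply: st; rewrite mem_undup mem_cat si orbT.
  by rewrite -big_split; apply: eq_bigr => i _; rewrite raddfD.
have K0 : exists2 s : seq int, uniq s & forall t : seq int,
    uniq t -> {subset s <= t} -> 0 = \sum_(i <- t) tensI_pr i 0.
  by exists [::] => // t _ _; rewrite big1 // => i _; rewrite raddf0.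
have [N [M ->]] := tensI_sum x; apply: (KD).
  elim/big_ind: _ => [|y z|n _]; [exact: K0|exact: KD|].
have [s us sP] := cx_supp (x.1 n).
  exists s => // t ut st; rewrite {1}(sP t) // raddf_sum.
  by apply: eq_bigr => i _; rewrite tensI_pr_mI.
elim/big_ind: _ => [|y z|n _]; [exact: K0|exact: KD|].
have [s us sP] := cx_supp (x.2 n).
exists [seq i - 1 | i <- s]; first by rewrite map_inj_uniq //; apply: addIr.
move=> t ut st; rewrite {1}(sP [seq i + 1 | i <- t]); first last.
- move=> i si; apply/mapP; exists (i - 1); last by rewrite subrK.
  exact/st/map_f.
- by rewrite map_inj_uniq //; apply: addIr.
rewrite big_map raddf_sum; apply: eq_bigr => i _; by rewrite tensI_pr_mdI.
Qed.

Lemma tensI_prd i x : tensI_pr i (tensI_d x) = tensI_d (tensI_pr (i + 1) x).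
Proof.
rewrite /tensI_pr /tensI_d /=; congr (_, _); apply/vpolyP => n /=.
  by rewrite cx_prd.
transitivity (cx_pr C (i + 1) (cx_d C (x.2 n) + n.+1%:R *: gsign (x.1 n.+1))).
  by [].
by rewrite raddfD /= linearZ /= cx_prd -gsign_pr.
Qed.

Lemma tensI_dd x : tensI_d (tensI_d x) = 0.
Proof.
rewrite /tensI_d /=; congr (_, _); apply/vpolyP => n /=; first exact: cx_dd.
transitivity (cx_d C (cx_d C (x.2 n) + n.+1%:R *: gsign (x.1 n.+1)) +
  n.+1%:R *: gsign (cx_d C (x.1 n.+1))); first by [].
by rewrite raddfD /= linearZ /= cx_dd add0r gsign_d scalerN subrr.
Qed.

Definition tensI : complex k :=
  @Complex k (vpoly C * vpoly C)%type tensI_pr tensI_d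
    tensI_prK tensI_fin tensI_prd tensI_dd.

Lemma mI_homog i a v : homog i v -> homog i (mI a v : tensI).
Proof. by rewrite /homog /= tensI_pr_mI => ->. Qed.
Lemma mdI_homog i a v : homog (i + 1) v -> homog i (mdI a v : tensI).
Proof. by rewrite /homog /= tensI_pr_mdI => ->. Qed.

Lemma tensI_hind i (K : tensI -> Prop) : K 0 ->
  (forall x y, K x -> K y -> K (x + y)) ->
  (forall a v, homog i v -> K (mI a v)) ->
  (forall a v, homog (i + 1) v -> K (mdI a v)) ->
  forall x, homog i x -> K x.
Proof.
move=> K0 KD K1 K2 x xi; have [N [M ->]] := tensI_sum x.
have xi1 n : homog i (x.1 n) by rewrite -xi; apply: homog_pr.
have xi2 n : homog (i + 1) (x.2 n) by rewrite -xi; apply: homog_pr.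
apply: (KD); elim/big_ind: _ => // n _; [exact: K1|exact: K2].
Qed.

Lemma tensI_ind (K : tensI -> Prop) : K 0 ->
  (forall x y, K x -> K y -> K (x + y)) ->
  (forall i a v, homog i v -> K (mI a v)) ->
  (forall i a v, homog i v -> K (mdI a v)) ->
  forall x, K x.
Proof.
move=> K0 KD K1 K2; elim/cx_ind => // i x; elim/tensI_hind => //.
  exact: K1.
exact: K2.
Qed.

Definition evI (c : k) (x : tensI) : C := vev c x.1.

Lemma evI_linear c : linear (evI c).
Proof. by move=> e x y; rewrite /evI /= linearP. Qed.
HB.instance Definition _ c :=
  GRing.isLinear.Build k tensI C _ (evI c) (evI_linear c).

End TensorI.

Section TensorIMap.
Variables (k : fieldType) (C D : complex k) (f : {linear C -> D}).

Definition tensI_map (x : tensI C) : tensI D := (vmap f x.1, vmap f x.2).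

Lemma tensI_map_linear : linear tensI_map.
Proof. by move=> c x y; rewrite /tensI_map /= !linearP. Qed.
HB.instance Definition _ := GRing.isLinear.Build k (tensI C) (tensI D) _
  tensI_map tensI_map_linear.

Lemma tensI_map_mI a v : tensI_map (mI a v) = mI a (f v).
Proof. by rewrite /tensI_map /= vmap_mono raddf0. Qed.
Lemma tensI_map_mdI a v : tensI_map (mdI a v) = mdI a (f v).
Proof. by rewrite /tensI_map /= vmap_mono raddf0. Qed.

Hypothesis f_pr : forall i x, f (cx_pr C i x) = cx_pr D i (f x).

Lemma tensI_map_pr i x :
  tensI_map (cx_pr (tensI C) i x) = cx_pr (tensI D) i (tensI_map x).
Proof.
by congr (_, _); apply/vpolyP => n /=; rewrite f_pr.
Qed.

Lemma gsign_map x : f (gsign x) = gsign (f x).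
Proof.
elim/cx_ind: x => [|x y xE yE|j x xj]; first by rewrite !raddf0.
  by rewrite !raddfD /= xE yE.
rewrite (gsign_homog xj) linearZ /= (@gsign_homog _ _ j) //.
by rewrite /homog -f_pr xj.
Qed.

Lemma tensI_map_d : (forall x, f (cx_d C x) = cx_d D (f x)) ->
  forall x, tensI_map (cx_d (tensI C) x) = cx_d (tensI D) (tensI_map x).
Proof.
move=> f_d x; congr (_, _); apply/vpolyP => n /=; first by rewrite f_d.
transitivity (f (cx_d C (x.2 n) + n.+1%:R *: gsign (x.1 n.+1))); first by [].
by rewrite raddfD /= linearZ /= f_d gsign_map.
Qed.
End TensorIMap.

(* (v a) (w b) = (-1)^(|a||w|) f(v, w) (a b), for a, b in k[t, dt].           *)
Section TensorIConv.
Variables (k : fieldType) (U V W : complex k) (f : U -> V -> W).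
Hypothesis fl : forall b, linear (fun a => f a b).
Hypothesis fr : forall a, linear (f a).

Definition tensI_conv (x : tensI U) (y : tensI V) : tensI W :=
  (vconv fl fr x.1 y.1,
   vconv fl fr x.1 y.2 + vconv fl fr x.2 (vmap (@gsign k V) y.1)).

Let f0l b : f 0 b = 0.
Proof. by have := fl b (-1) 0 0; rewrite !scaler0 scaleN1r addr0 addNr. Qed.
Let f0r a : f a 0 = 0.
Proof. by have := fr a (-1) 0 0; rewrite !scaler0 scaleN1r addr0 addNr. Qed.

Lemma tensI_convl y : linear (fun x => tensI_conv x y).
Proof.
move=> c x x'; rewrite /tensI_conv /= !vconv_linl; congr (_, _).
by rewrite /= scalerDr addrACA.
Qed.
Lemma tensI_convr x : linear (tensI_conv x).
Proof.
move=> c y y'; rewrite /tensI_conv /= !linearP !vconv_linr; congr (_, _).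
by rewrite /= scalerDr addrACA.
Qed.

Lemma tensI_conv0l y : tensI_conv 0 y = 0.
Proof.
by have := tensI_convl y (-1) 0 0; rewrite !scaler0 scaleN1r addr0 addNr.
Qed.
Lemma tensI_conv0r x : tensI_conv x 0 = 0.
Proof.
by have := tensI_convr x (-1) 0 0; rewrite !scaler0 scaleN1r addr0 addNr.
Qed.
Lemma tensI_convDl x x' y :
  tensI_conv (x + x') y = tensI_conv x y + tensI_conv x' y.
Proof. by have := tensI_convl y 1 x x'; rewrite !scale1r. Qed.
Lemma tensI_convDr x y y' :
  tensI_conv x (y + y') = tensI_conv x y + tensI_conv x y'.
Proof. by have := tensI_convr x 1 y y'; rewrite !scale1r. Qed.
Lemma tensI_convZl c x y : tensI_conv (c *: x) y = c *: tensI_conv x y.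
Proof. by have := tensI_convl y c x 0; rewrite !addr0 tensI_conv0l addr0. Qed.
Lemma tensI_convZr c x y : tensI_conv x (c *: y) = c *: tensI_conv x y.
Proof. by have := tensI_convr x c y 0; rewrite !addr0 tensI_conv0r addr0. Qed.

Let conv0l q : vconv fl fr 0 q = 0.
Proof.
by have := vconv_linl fl fr q (-1) 0 0; rewrite !scaler0 scaleN1r addr0 addNr.
Qed.
Let conv0r p : vconv fl fr p 0 = 0.
Proof.
by have := vconv_linr fl fr p (-1) 0 0; rewrite !scaler0 scaleN1r addr0 addNr.
Qed.

Lemma conv_mm a b v w : tensI_conv (mI a v) (mI b w) = mI (a + b) (f v w).
Proof. by rewrite /tensI_conv /= vconv_mono conv0l conv0r addr0. Qed.
Lemma conv_md a b v w : tensI_conv (mI a v) (mdI b w) = mdI (a + b) (f v w).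
Proof. by rewrite /tensI_conv /= vconv_mono conv0l conv0r addr0. Qed.
Lemma conv_dm a b v w :
  tensI_conv (mdI a v) (mI b w) = mdI (a + b) (f v (gsign w)).
Proof.
by rewrite /tensI_conv /= vmap_mono vconv_mono !conv0l add0r.
Qed.
Lemma conv_dd a b v w : tensI_conv (mdI a v) (mdI b w) = 0.
Proof. by rewrite /tensI_conv /= raddf0 !conv0l conv0r addr0. Qed.

Hypothesis f_homog : forall p q a b,
  homog p a -> homog q b -> homog (p + q) (f a b).

Lemma gsign_bil v w : gsign (f v w) = f (gsign v) (gsign w).
Proof.
have fDl b : {morph (fun a => f a b) : x y / x + y}.
  by move=> x y; have := fl b 1 x y; rewrite !scale1r.
have fDr a : {morph f a : x y / x + y}.
  by move=> x y; have := fr a 1 x y; rewrite !scale1r.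
have fZl c a b : f (c *: a) b = c *: f a b.
  by have := fl b c a 0; rewrite !addr0 f0l addr0.
have fZr c a b : f a (c *: b) = c *: f a b.
  by have := fr a c b 0; rewrite !addr0 f0r addr0.
elim/cx_ind: v => [|x y xE yE|i v vi]; first by rewrite raddf0 !f0l raddf0.
  by rewrite fDl !raddfD /= xE yE fDl.
elim/cx_ind: w => [|x y xE yE|j w wj]; first by rewrite raddf0 !f0r raddf0.
  by rewrite fDr !raddfD /= xE yE fDr.
rewrite (gsign_homog vi) (gsign_homog wj) (gsign_homog (f_homog vi wj)).
by rewrite signD fZl fZr scalerA.
Qed.

Lemma tensI_conv_homog p q x y :
  homog p x -> homog q y -> homog (p + q) (tensI_conv x y).
Proof.
move=> xp yq; elim/tensI_hind: xp => [|x1 x2 H1 H2|a v vp|a v vp].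
- by rewrite tensI_conv0l; apply: homog0.
- by rewrite tensI_convDl; apply: homogD.
- elim/tensI_hind: yq => [|y1 y2 H1 H2|b w wq|b w wq].
  + by rewrite tensI_conv0r; apply: homog0.
  + by rewrite tensI_convDr; apply: homogD.
  + by rewrite conv_mm; apply/mI_homog/f_homog.
  + by rewrite conv_md; apply: mdI_homog; rewrite -addrA; apply: f_homog.
- elim/tensI_hind: yq => [|y1 y2 H1 H2|b w wq|b w wq].
  + by rewrite tensI_conv0r; apply: homog0.
  + by rewrite tensI_convDr; apply: homogD.
  + rewrite conv_dm; apply: mdI_homog; rewrite addrAC; apply: f_homog => //.
    by rewrite (gsign_homog wq); apply: homogZ.
  + by rewrite conv_dd; apply: homog0.
Qed.

Hypothesis f_d : forall p a b, homog p a ->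
  cx_d W (f a b) = f (cx_d U a) b + ((-1) ^ p : k) *: f a (cx_d V b).

Lemma tensI_conv_d p x y : homog p x ->
  cx_d (tensI W) (tensI_conv x y) = tensI_conv (cx_d (tensI U) x) y +
    ((-1) ^ p : k) *: tensI_conv x (cx_d (tensI V) y).
Proof.
have fZl c a b : f (c *: a) b = c *: f a b.
  by have := fl b c a 0; rewrite !addr0 f0l addr0.
have fZr c a b : f a (c *: b) = c *: f a b.
  by have := fr a c b 0; rewrite !addr0 f0r addr0.
move=> xp; elim/tensI_ind: y => [|y1 y2 H1 H2|q b w wq|q b w wq].
- by rewrite raddf0 !tensI_conv0r raddf0 scaler0 addr0.
- rewrite tensI_convDr !raddfD /= H1 H2 !tensI_convDr scalerDr.
  by rewrite addrACA.
- elim/tensI_hind: xp => [|x1 x2 H1 H2|a v vp|a v vp].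
  + by rewrite raddf0 !tensI_conv0l raddf0 scaler0 addr0.
  + rewrite tensI_convDl !raddfD /= H1 H2 !tensI_convDl scalerDr.
    by rewrite addrACA.
  + rewrite conv_mm /= !tensI_d_mI !(tensI_convDl, tensI_convDr).
    rewrite tensI_convZl tensI_convZr !conv_mm !conv_dm conv_md (f_d _ vp).
    rewrite mID mIZ scalerDr [RHS]addrACA; congr (_ + _).
    rewrite gsign_bil (gsign_homog vp) (gsign_homog wq) !fZl !fZr.
    rewrite !mdIZ !scalerA natrD !mulrDl scalerDl; congr (_ + _).
      case: a => [|a]; last by rewrite addSn.
      by rewrite !(mul0r, mulr0) !scale0r.
    case: b => [|b]; first by rewrite !(mul0r, mulr0) !scale0r.
    rewrite addnS /=; congr (_ *: _).
    by move: ((-1) ^ p) ((-1) ^ q) => A B; ring.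
  + rewrite conv_dm /= tensI_d_mI !tensI_d_mdI !tensI_convDr !conv_dm.
    rewrite tensI_convZr conv_dd scaler0 addr0 (f_d _ vp) mdID mdIZ.
    rewrite (gsign_d w) -[- cx_d V _]scaleN1r fZr signD expr1z !mdIZ.
    by rewrite !scalerA (mulrC _ (-1)).
- elim/tensI_hind: xp => [|x1 x2 H1 H2|a v vp|a v vp].
  + by rewrite raddf0 !tensI_conv0l raddf0 scaler0 addr0.
  + rewrite tensI_convDl !raddfD /= H1 H2 !tensI_convDl scalerDr.
    by rewrite addrACA.
  + rewrite conv_md /= tensI_d_mI !tensI_d_mdI !tensI_convDl !conv_md.
    by rewrite tensI_convZl conv_dd scaler0 addr0 (f_d _ vp) mdID mdIZ.
  + by rewrite conv_dd /= !tensI_d_mdI !conv_dd raddf0 scaler0 addr0.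
Qed.

Lemma evI_conv c x y : evI c (tensI_conv x y) = f (evI c x) (evI c y).
Proof.
have fDl b : {morph (fun a => f a b) : x y / x + y}.
  by move=> x' y'; have := fl b 1 x' y'; rewrite !scale1r.
have fDr a : {morph f a : x y / x + y}.
  by move=> x' y'; have := fr a 1 x' y'; rewrite !scale1r.
have fZl e a b : f (e *: a) b = e *: f a b.
  by have := fl b e a 0; rewrite !addr0 f0l addr0.
have fZr e a b : f a (e *: b) = e *: f a b.
  by have := fr a e b 0; rewrite !addr0 f0r addr0.
have evm (C : complex k) a (v : C) : evI c (mI a v) = c ^+ a *: v.
  exact: vev_mono.
have evd (C : complex k) a (v : C) : evI c (mdI a v) = 0.
  by rewrite /evI /= raddf0.
elim/tensI_ind: x => [|x1 x2 H1 H2|p a v vp|p a v vp].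
- by rewrite tensI_conv0l !raddf0 f0l.
- by rewrite tensI_convDl !raddfD /= H1 H2 fDl.
- elim/tensI_ind: y => [|y1 y2 H1 H2|q b w wq|q b w wq].
  + by rewrite tensI_conv0r !raddf0 f0r.
  + by rewrite tensI_convDr !raddfD /= H1 H2 fDr.
  + by rewrite conv_mm !evm fZl fZr scalerA exprD.
  + by rewrite conv_md !evd f0r.
- elim/tensI_ind: y => [|y1 y2 H1 H2|q b w wq|q b w wq].
  + by rewrite tensI_conv0r !raddf0 f0r.
  + by rewrite tensI_convDr !raddfD /= H1 H2 fDr.
  + by rewrite conv_dm !evd f0l.
  + by rewrite conv_dd !evd raddf0 f0l.
Qed.
End TensorIConv.

Section TensorIOp.
Variables (k : fieldType) (D : pred mtype) (P : modop k D).

Definition tensI_smod : smod k D.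
Proof.
refine (@Smod k D (fun u => tensI (P u)) (fun u s => tensI_map (sm_act P s))
  _ _ _ _).
- by move=> u s; apply/tensI_map_pr/sm_act_pr.
- by move=> u s; apply: tensI_map_d; [apply: sm_act_pr|apply: sm_act_d].
- by move=> u [x1 x2]; congr (_, _); apply/vpolyP => n /=; rewrite sm_act1.
- by move=> u s t x; congr (_, _); apply/vpolyP => n /=; rewrite sm_actM.
Defined.

Definition tensI_comp (u v w : idx D) (e : glue u v w) (i : 'I_(legs u)) :
    tensI_smod u -> tensI_smod v -> tensI_smod w :=
  tensI_conv (op_compl e i) (op_compr e i).

Definition tensI_contr (u w : idx D) (i j : 'I_(legs u)) (ij : i != j)
    (e : selfglue u w) : {linear tensI_smod u -> tensI_smod w} :=
  tensI_map (op_contr P ij e).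

Lemma comp_mm u v w e i a b x y :
  @tensI_comp u v w e i (mI a x) (mI b y) = mI (a + b) (op_comp P e i x y).
Proof. exact: conv_mm. Qed.
Lemma comp_md u v w e i a b x y :
  @tensI_comp u v w e i (mI a x) (mdI b y) = mdI (a + b) (op_comp P e i x y).
Proof. exact: conv_md. Qed.
Lemma comp_dm u v w e i a b x y : @tensI_comp u v w e i (mdI a x) (mI b y) =
  mdI (a + b) (op_comp P e i x (gsign y)).
Proof. exact: conv_dm. Qed.
Lemma comp_dd u v w e i a b x y :
  @tensI_comp u v w e i (mdI a x) (mdI b y) = 0.
Proof. exact: conv_dd. Qed.
Lemma comp0l u v w e i y : @tensI_comp u v w e i 0 y = 0.
Proof. exact: tensI_conv0l. Qed.
Lemma comp0r u v w e i x : @tensI_comp u v w e i x 0 = 0.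
Proof. exact: tensI_conv0r. Qed.
Lemma compDl u v w e i x x' y : @tensI_comp u v w e i (x + x') y =
  tensI_comp e i x y + tensI_comp e i x' y.
Proof. exact: tensI_convDl. Qed.
Lemma compDr u v w e i x y y' : @tensI_comp u v w e i x (y + y') =
  tensI_comp e i x y + tensI_comp e i x y'.
Proof. exact: tensI_convDr. Qed.
Lemma act_m u s a x : sm_act tensI_smod s (mI a x) = mI a (@sm_act _ _ P u s x).
Proof. exact: tensI_map_mI. Qed.
Lemma act_d u s a x : sm_act tensI_smod s (mdI a x) =
  mdI a (@sm_act _ _ P u s x).
Proof. exact: tensI_map_mdI. Qed.
Lemma contr_m u w i j ij e a x : @tensI_contr u w i j ij e (mI a x) =
  mI a (op_contr P ij e x).
Proof. exact: tensI_map_mI. Qed.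
Lemma contr_d u w i j ij e a x : @tensI_contr u w i j ij e (mdI a x) =
  mdI a (op_contr P ij e x).
Proof. exact: tensI_map_mdI. Qed.
Let monoE := (comp_mm, comp_md, comp_dm, comp_dd, act_m, act_d, contr_m,
  contr_d, comp0l, comp0r).

Lemma op_compZl (u v w : idx D) (e : glue u v w) i (c : k) (a : P u) (b : P v) :
  op_comp P e i (c *: a) b = c *: op_comp P e i a b.
Proof.
have l := op_compl e i b.
have h0 := l (-1) 0 0; rewrite !scaler0 scaleN1r addr0 addNr /= in h0.
by have := l c a 0; rewrite /= h0 !addr0.
Qed.
Lemma op_compZr (u v w : idx D) (e : glue u v w) i (c : k) (a : P u) (b : P v) :
  op_comp P e i a (c *: b) = c *: op_comp P e i a b.
Proof.
have l := op_compr e i a.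
have h0 := l (-1) 0 0; rewrite !scaler0 scaleN1r addr0 addNr /= in h0.
by have := l c b 0; rewrite h0 !addr0.
Qed.

Lemma sm_actZ (u : idx D) (s : 'S_(legs u)) (c : k) (x : P u) :
  sm_act P s (c *: x) = c *: sm_act P s x.
Proof. exact: linearZ. Qed.

Lemma gsign_act (u : idx D) (s : 'S_(legs u)) (x : P u) :
  gsign (sm_act P s x) = sm_act P s (gsign x).
Proof. by rewrite (gsign_map (sm_act_pr s)). Qed.
Lemma gsign_comp (u v w : idx D) (e : glue u v w) i (a : P u) (b : P v) :
  gsign (op_comp P e i a b) = op_comp P e i (gsign a) (gsign b).
Proof.
exact: (gsign_bil (op_compl e i) (op_compr e i) (@op_comp_homog _ _ P _ _ _ e i)).
Qed.

Lemma tensI_comp_act (u v w : idx D) (e : glue u v w) (i : 'I_(legs u))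
      (s : 'S_(legs u)) (t : 'S_(legs v)) (r : 'S_(legs w))
      (a : tensI_smod u) (b : tensI_smod v) :
    (forall z : 'I_(legs v), z = 0 :> nat -> t z = z) ->
    (forall (x : 'I_(legs w)) (y : 'I_(legs u)), y != i ->
       x = gluel (legs v) i y :> nat ->
       r x = gluel (legs v) (s i) (s y) :> nat) ->
    (forall (x : 'I_(legs w)) (y : 'I_(legs v)), (0 < y)%N ->
       x = gluer i y :> nat -> r x = gluer (s i) (t y) :> nat) ->
    tensI_comp e i (sm_act _ s a) (sm_act _ t b) =
      sm_act _ r (tensI_comp e (s i) a b).
Proof.
move=> h1 h2 h3.
have A a' b' := @op_comp_act k D P u v w e i s t r a' b' h1 h2 h3.
elim/tensI_ind: a => [|x y H1 H2|p a v' _|p a v' _].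
- by rewrite comp0l !raddf0 comp0l.
- by rewrite compDl !raddfD /= compDl H1 H2.
- elim/tensI_ind: b => [|x y H1 H2|q b w' _|q b w' _].
  + by rewrite comp0r !raddf0 comp0r.
  + by rewrite compDr !raddfD /= compDr H1 H2.
  + by rewrite !monoE A.
  + by rewrite !monoE A.
- elim/tensI_ind: b => [|x y H1 H2|q b w' _|q b w' _].
  + by rewrite comp0r !raddf0 comp0r.
  + by rewrite compDr !raddfD /= compDr H1 H2.
  + by rewrite !monoE gsign_act A.
  + by rewrite !monoE raddf0.
Qed.

Lemma tensI_compC (u v w : idx D) (e : glue u v w) (e' : glue v u w)
      (i : 'I_(legs u)) (j : 'I_(legs v)) (r : 'S_(legs w)) (p q : int)
      (a : tensI_smod u) (b : tensI_smod v) :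
    i = 0 :> nat -> j = 0 :> nat ->
    (forall (x : 'I_(legs w)) (y : 'I_(legs u)), (0 < y)%N ->
       x = gluel (legs v) i y :> nat -> r x = gluer j y :> nat) ->
    (forall (x : 'I_(legs w)) (y : 'I_(legs v)), (0 < y)%N ->
       x = gluer i y :> nat -> r x = gluel (legs u) j y :> nat) ->
    homog p a -> homog q b ->
    tensI_comp e i a b =
      ((-1) ^ (p * q) : k) *: sm_act _ r (tensI_comp e' j b a).
Proof.
move=> h1 h2 h3 h4 ap bq.
have nz : (-1 : k) != 0 by rewrite oppr_eq0 oner_eq0.
elim/tensI_hind: ap => [|x y H1 H2|a' v' hv|a' v' hv].
- by rewrite comp0l comp0r raddf0 scaler0.
- by rewrite compDl compDr raddfD scalerDr H1 H2.
- elim/tensI_hind: bq => [|x y H1 H2|b' w' hw|b' w' hw].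
  + by rewrite comp0l comp0r raddf0 scaler0.
  + by rewrite compDl compDr raddfD scalerDr H1 H2.
  + by rewrite !monoE (op_compC e e' h1 h2 h3 h4 hv hw) mIZ addnC.
  + rewrite !monoE (op_compC e e' h1 h2 h3 h4 hv hw) (gsign_homog hv).
    rewrite op_compZr sm_actZ !mdIZ scalerA addnC; congr (_ *: _).
    by rewrite mulrDr mulr1 expfzDr.
- elim/tensI_hind: bq => [|x y H1 H2|b' w' hw|b' w' hw].
  + by rewrite comp0l comp0r raddf0 scaler0.
  + by rewrite compDl compDr raddfD scalerDr H1 H2.
  + rewrite !monoE (gsign_homog hw) op_compZr.
    rewrite (op_compC e e' h1 h2 h3 h4 hv hw) scalerA mdIZ addnC.
    congr (_ *: _); rewrite -expfzDr // mulrDl mul1r.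
    have -> : q + (p * q + q) = p * q + (q + q) by ring.
    by rewrite !expfzDr // -expfzMl mulrNN mulr1 exp1rz mulr1.
  + by rewrite !monoE raddf0 scaler0.
Qed.

Lemma tensI_compA (u v w uv vw z : idx D)
      (e1 : glue u v uv) (e2 : glue uv w z) (e3 : glue v w vw)
      (e4 : glue u vw z) (i : 'I_(legs u)) (j : 'I_(legs v))
      (j' : 'I_(legs uv)) (a : tensI_smod u) (b : tensI_smod v)
      (c : tensI_smod w) :
    (0 < j)%N -> j' = gluer i j :> nat ->
    tensI_comp e2 j' (tensI_comp e1 i a b) c =
    tensI_comp e4 i a (tensI_comp e3 j b c).
Proof.
move=> h1 h2; have A a' b' c' :=
  @op_compA k D P u v w uv vw z e1 e2 e3 e4 i j j' a' b' c' h1 h2.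
elim/tensI_ind: a => [|x y H1 H2|p a v1 _|p a v1 _].
- by rewrite !monoE.
- by rewrite !compDl H1 H2.
- elim/tensI_ind: b => [|x y H1 H2|q b v2 _|q b v2 _].
  + by rewrite !monoE.
  + by rewrite !(compDl, compDr) H1 H2.
  + elim/tensI_ind: c => [|x y H1 H2|l c v3 _|l c v3 _].
    * by rewrite !monoE.
    * by rewrite !compDr H1 H2.
    * by rewrite !monoE A addnA.
    * by rewrite !monoE A addnA.
  + elim/tensI_ind: c => [|x y H1 H2|l c v3 _|l c v3 _].
    * by rewrite !monoE.
    * by rewrite !compDr H1 H2.
    * by rewrite !monoE A addnA.
    * by rewrite !monoE.
- elim/tensI_ind: b => [|x y H1 H2|q b v2 _|q b v2 _].
  + by rewrite !monoE.
  + by rewrite !(compDl, compDr) H1 H2.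
  + elim/tensI_ind: c => [|x y H1 H2|l c v3 _|l c v3 _].
    * by rewrite !monoE.
    * by rewrite !compDr H1 H2.
    * by rewrite !monoE gsign_comp A addnA.
    * by rewrite !monoE.
  + elim/tensI_ind: c => [|x y H1 H2|l c v3 _|l c v3 _].
    * by rewrite !monoE.
    * by rewrite !compDr H1 H2.
    * by rewrite !monoE.
    * by rewrite !monoE.
Qed.

Lemma tensI_compAC (u v w uv uw z : idx D)
      (e1 : glue u v uv) (e2 : glue uv w z) (e3 : glue u w uw)
      (e4 : glue uw v z) (i j : 'I_(legs u))
      (j' : 'I_(legs uv)) (i' : 'I_(legs uw)) (p q : int)
      (a : tensI_smod u) (b : tensI_smod v) (c : tensI_smod w) :
    i != j -> j' = gluel (legs v) i j :> nat ->
    i' = gluel (legs w) j i :> nat ->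
    homog p b -> homog q c ->
    tensI_comp e2 j' (tensI_comp e1 i a b) c =
      ((-1) ^ (p * q) : k) *: tensI_comp e4 i' (tensI_comp e3 j a c) b.
Proof.
move=> h1 h2 h3 bp cq.
have nz : (-1 : k) != 0 by rewrite oppr_eq0 oner_eq0.
have sq (n : int) : (-1 : k) ^ n * (-1) ^ n = 1.
  by rewrite -expfzMl mulrNN mulr1 exp1rz.
have A p' q' a' b' c' :=
  @op_compAC k D P u v w uv uw z e1 e2 e3 e4 i j j' i' p' q' a' b' c' h1 h2 h3.
elim/tensI_ind: a => [|x y H1 H2|n a v1 _|n a v1 _].
- by rewrite !monoE scaler0.
- by rewrite !compDl H1 H2 scalerDr.
- elim/tensI_hind: bp => [|x y H1 H2|b' v2 hv|b' v2 hv].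
  + by rewrite !monoE scaler0.
  + by rewrite !(compDl, compDr) H1 H2 scalerDr.
  + elim/tensI_hind: cq => [|x y H1 H2|c' v3 hw|c' v3 hw].
    * by rewrite !monoE scaler0.
    * by rewrite !(compDl, compDr) H1 H2 scalerDr.
    * by rewrite !monoE (A _ _ _ _ _ hv hw) mIZ addnAC.
    * rewrite !monoE (A _ _ _ _ _ hv hw) (gsign_homog hv) op_compZr !mdIZ.
      by rewrite scalerA addnAC mulrDr mulr1 expfzDr.
  + elim/tensI_hind: cq => [|x y H1 H2|c' v3 hw|c' v3 hw].
    * by rewrite !monoE scaler0.
    * by rewrite !(compDl, compDr) H1 H2 scalerDr.
    * rewrite !monoE (gsign_homog hw) op_compZr (A _ _ _ _ _ hv hw) !mdIZ.
      by rewrite scalerA addnAC mulrDl mul1r expfzDr // mulrCA sq mulr1.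
    * by rewrite !monoE scaler0.
- elim/tensI_hind: bp => [|x y H1 H2|b' v2 hv|b' v2 hv].
  + by rewrite !monoE scaler0.
  + by rewrite !(compDl, compDr) H1 H2 scalerDr.
  + elim/tensI_hind: cq => [|x y H1 H2|c' v3 hw|c' v3 hw].
    * by rewrite !monoE scaler0.
    * by rewrite !(compDl, compDr) H1 H2 scalerDr.
    * rewrite !monoE (gsign_homog hw) (gsign_homog hv) !op_compZr !op_compZl.
      rewrite (A _ _ _ _ _ hv hw) !mdIZ !scalerA addnAC; congr (_ *: _).
      by move: ((-1) ^ (p * q)) ((-1) ^ p) ((-1) ^ q) => x y z'; ring.
    * by rewrite !monoE scaler0.
  + elim/tensI_hind: cq => [|x y H1 H2|c' v3 hw|c' v3 hw].
    * by rewrite !monoE scaler0.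
    * by rewrite !(compDl, compDr) H1 H2 scalerDr.
    * by rewrite !monoE scaler0.
    * by rewrite !monoE scaler0.
Qed.

Lemma tensI_contr_comp (u v uv u' w : idx D) (e1 : glue u v uv)
      (e2 : selfglue uv w) (e3 : selfglue u u') (e4 : glue u' v w)
      (l i j : 'I_(legs u)) (i' j' : 'I_(legs uv)) (l' : 'I_(legs u'))
      (ij : i != j) (ij' : i' != j') (a : tensI_smod u) (b : tensI_smod v) :
    i != l -> j != l ->
    i' = gluel (legs v) l i :> nat -> j' = gluel (legs v) l j :> nat ->
    l' = selfpos i j l :> nat ->
    tensI_contr ij' e2 (tensI_comp e1 l a b) =
      tensI_comp e4 l' (tensI_contr ij e3 a) b.
Proof.
move=> h1 h2 h3 h4 h5.
have A a' b' := @op_contr_comp k D P u v uv u' w e1 e2 e3 e4 l i j i' j' l'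
  ij ij' a' b' h1 h2 h3 h4 h5.
elim/tensI_ind: a => [|x y H1 H2|p a v1 _|p a v1 _].
- by rewrite comp0l !raddf0 comp0l.
- by rewrite compDl !raddfD /= compDl H1 H2.
- elim/tensI_ind: b => [|x y H1 H2|q b v2 _|q b v2 _].
  + by rewrite !comp0r raddf0.
  + by rewrite !compDr raddfD /= H1 H2.
  + by rewrite !monoE A.
  + by rewrite !monoE A.
- elim/tensI_ind: b => [|x y H1 H2|q b v2 _|q b v2 _].
  + by rewrite !comp0r raddf0.
  + by rewrite !compDr raddfD /= H1 H2.
  + by rewrite !monoE A.
  + by rewrite !monoE raddf0.
Qed.

Lemma tensI_contr_comp2 (u v uv w : idx D) (e1 : glue u v uv)
      (e2 : selfglue uv w) (l i : 'I_(legs u)) (z j : 'I_(legs v))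
      (i1 j1 l2 j2 : 'I_(legs uv)) (ij : i1 != j1) (lj : l2 != j2)
      (r : 'S_(legs w)) (a : tensI_smod u) (b : tensI_smod v) :
    z = 0 :> nat -> (0 < j)%N -> i != l ->
    i1 = gluel (legs v) l i :> nat -> j1 = gluer l j :> nat ->
    l2 = gluel (legs v) i l :> nat -> j2 = gluer i j :> nat ->
    (forall (x : 'I_(legs w)) (y : 'I_(legs u)), y != i -> y != l ->
       x = selfpos i1 j1 (gluel (legs v) l y) :> nat ->
       r x = selfpos l2 j2 (gluel (legs v) i y) :> nat) ->
    (forall (x : 'I_(legs w)) (y : 'I_(legs v)), y != z -> y != j ->
       x = selfpos i1 j1 (gluer l y) :> nat ->
       r x = selfpos l2 j2 (gluer i y) :> nat) ->
    tensI_contr ij e2 (tensI_comp e1 l a b) =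
      sm_act _ r (tensI_contr lj e2 (tensI_comp e1 i a (sm_act _ (tperm z j) b))).
Proof.
move=> h1 h2 h3 h4 h5 h6 h7 h8 h9.
have A a' b' := @op_contr_comp2 k D P u v uv w e1 e2 l i z j i1 j1 l2 j2 ij lj r
  a' b' h1 h2 h3 h4 h5 h6 h7 h8 h9.
elim/tensI_ind: a => [|x y H1 H2|p a v1 _|p a v1 _].
- by rewrite !comp0l !raddf0.
- by rewrite !compDl !raddfD /= H1 H2.
- elim/tensI_ind: b => [|x y H1 H2|q b v2 _|q b v2 _].
  + by rewrite raddf0 !comp0r !raddf0.
  + by rewrite raddfD /= !compDr !raddfD /= H1 H2.
  + by rewrite !monoE A.
  + by rewrite !monoE A.
- elim/tensI_ind: b => [|x y H1 H2|q b v2 _|q b v2 _].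
  + by rewrite raddf0 !comp0r !raddf0.
  + by rewrite raddfD /= !compDr !raddfD /= H1 H2.
  + by rewrite !monoE A gsign_act.
  + by rewrite !monoE !raddf0.
Qed.

(* P (x) k[t, dt] *)
Definition tensI_op : modop k D.
Proof.
refine (@Modop k D tensI_smod tensI_comp tensI_contr _ _ _ _ _ _
  tensI_comp_act _ tensI_compC tensI_compA tensI_compAC _ _
  tensI_contr_comp tensI_contr_comp2).
- by move=> u v w e i b; apply: tensI_convl.
- by move=> u v w e i b; apply: tensI_convr.
- by move=> u v w e i p q a b; apply/tensI_conv_homog/op_comp_homog.
- move=> u v w e i p a b; apply: tensI_conv_d; first exact: op_comp_homog.
  by move=> p' a' b'; apply: op_comp_d.
- by move=> u w i j ij e p a; apply/tensI_map_pr/op_contr_pr.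
- move=> u w i j ij e a; apply: tensI_map_d; first exact: op_contr_pr.
  exact: op_contr_d.
- move=> u w e s i j ij sij r a h; congr (_, _); apply/vpolyP => n /=;
  exact: op_contr_act.
- move=> u w e i j ij ji a; congr (_, _); apply/vpolyP => n /=;
  exact: op_contr_sym.
- move=> u v v' w e1 e2 e3 e4 i j l m l' m' i' j' ij lm lm' ij' a h1 h2 h3 h4 h5.
  by congr (_, _); apply/vpolyP => n /=; apply: op_contrAC.
Defined.

(* Evaluation at [t = c], [dt = 0].                                           *)
Definition eval_op (c : k) : mor tensI_op P.
Proof.
refine (@Mor k D tensI_op P (fun u => @evI k (P u) c) _ _ _ _ _).
- by move=> u i x; rewrite /= /evI /=; exact: vev_vmap.
- by move=> u x; rewrite /= /evI /=; exact: vev_vmap.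
- by move=> u s x; rewrite /= /evI /=; exact: vev_vmap.
- by move=> u v w e i a b; apply/evI_conv.
- by move=> u w i j ij e a; rewrite /= /evI /=; exact: vev_vmap.
Defined.
End TensorIOp.

Definition elementary_homotopy (k : fieldType) (D : pred mtype)
    (P Q : modop k D) (f0 f1 : mor P Q) : Prop :=
  exists h : mor P (tensI_op Q),
    eqmor (mor_comp (eval_op Q 0) h) f0 /\ eqmor (mor_comp (eval_op Q 1) h) f1.

Definition homotopic (k : fieldType) (D : pred mtype) (P Q : modop k D) :
    mor P Q -> mor P Q -> Prop :=
  clos_refl_sym_trans (mor P Q) (@elementary_homotopy k D P Q).

Section Truncation.
Variables (k : fieldType) (n : int).

Definition trunc_smod (P : smod k predT) : smod k (dim_le n).
Proof.
refine (@Smod k (dim_le n) (fun u => P (full u))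
  (fun u s => @sm_act k predT P (full u) s) _ _ _ _).
- by move=> u; apply: (@sm_act_pr k predT P (full u)).
- by move=> u; apply: (@sm_act_d k predT P (full u)).
- by move=> u; apply: (@sm_act1 k predT P (full u)).
- by move=> u; apply: (@sm_actM k predT P (full u)).
Defined.

Definition trunc (P : modop k predT) : modop k (dim_le n).
Proof.
refine (@Modop k (dim_le n) (trunc_smod P)
  (fun u v w e i => @op_comp k predT P (full u) (full v) (full w) e i)
  (fun u w i j ij e => @op_contr k predT P (full u) (full w) i j ij e)
  _ _ _ _ _ _ _ _ _ _ _ _ _ _ _).
- by move=> u v w; apply: (@op_compl k predT P (full u) (full v) (full w)).
- by move=> u v w; apply: (@op_compr k predT P (full u) (full v) (full w)).
- by move=> u v w;
    apply: (@op_comp_homog k predT P (full u) (full v) (full w)).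
- by move=> u v w; apply: (@op_comp_d k predT P (full u) (full v) (full w)).
- by move=> u w; apply: (@op_contr_pr k predT P (full u) (full w)).
- by move=> u w; apply: (@op_contr_d k predT P (full u) (full w)).
- by move=> u v w; apply: (@op_comp_act k predT P (full u) (full v) (full w)).
- by move=> u w; apply: (@op_contr_act k predT P (full u) (full w)).
- by move=> u v w; apply: (@op_compC k predT P (full u) (full v) (full w)).
- by move=> u v w uv vw z; apply: (@op_compA k predT P (full u) (full v)
    (full w) (full uv) (full vw) (full z)).
- by move=> u v w uv uw z; apply: (@op_compAC k predT P (full u) (full v)
    (full w) (full uv) (full uw) (full z)).
- by move=> u w; apply: (@op_contr_sym k predT P (full u) (full w)).
- by move=> u v v' w; apply: (@op_contrAC k predT P (full u) (full v)
    (full v') (full w)).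
- by move=> u v uv u' w; apply: (@op_contr_comp k predT P (full u) (full v)
    (full uv) (full u') (full w)).
- by move=> u v uv w; apply: (@op_contr_comp2 k predT P (full u) (full v)
    (full uv) (full w)).
Defined.

Definition trunc_mor (P Q : modop k predT) (f : mor P Q) :
  mor (trunc P) (trunc Q).
Proof.
refine (@Mor k (dim_le n) (trunc P) (trunc Q) (fun u => f (full u)) _ _ _ _ _).
- by move=> u; apply: (@mor_pr k predT P Q f (full u)).
- by move=> u; apply: (@mor_d k predT P Q f (full u)).
- by move=> u; apply: (@mor_act k predT P Q f (full u)).
- by move=> u v w;
    apply: (@mor_op_comp k predT P Q f (full u) (full v) (full w)).
- by move=> u w; apply: (@mor_op_contr k predT P Q f (full u) (full w)).
Defined.

(* [T], with the unit [eta], is the value at [X] of the left adjoint of       *)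
(* [trunc].                                                                   *)
Definition is_left_adjoint_trunc (X : modop k (dim_le n)) (T : modop k predT)
    (eta : mor X (trunc T)) : Prop :=
  forall (Q : modop k predT) (phi : mor X (trunc Q)),
    exists2 f : mor T Q, eqmor (mor_comp (trunc_mor f) eta) phi &
      forall f' : mor T Q,
        eqmor (mor_comp (trunc_mor f') eta) phi -> eqmor f' f.

End Truncation.
Arguments trunc {k} n P.

Definition smod_map (k : fieldType) (D : pred mtype) (V W : smod k D) (e : int)
    (f : forall u, {linear V u -> W u}) : Prop :=
  (forall u i x, f u (cx_pr _ i x) = cx_pr _ (i + e) (f u x)) /\
  (forall (u : idx D) (s : 'S_(legs u)) x,
     f u (sm_act V s x) = sm_act W s (f u x)).

(* A chain map [V[-1] -> P_n], for [V] with zero differential and             *)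
(* concentrated in modular dimension [n], is an equivariant map [V -> P] of   *)
(* degree -1 with values in cycles.                                           *)
Definition attaching_data (k : fieldType) (P : modop k predT) (n : int)
    (V : smod k predT) (xi : forall u, {linear V u -> P u}) : Prop :=
  [/\ forall (u : idx predT) (x : V u), cx_d _ x = 0,
      forall (u : idx predT), dim u != n -> forall x : V u, x = 0,
      smod_map (-1) xi
    & forall u x, cx_d _ (xi u x) = 0].

(* [E], with [j : P -> E] and [g : V -> E], represents the functor sending    *)
(* [Q] to the set of pairs (f, h), with [f : P -> Q] a morphism and           *)
(* [h : V -> Q] equivariant of degree 0, such that [d h = f xi].              *)
Definition is_principal_extension (k : fieldType) (P : modop k predT)
    (V : smod k predT) (xi : forall u, {linear V u -> P u})
    (E : modop k predT) (j : mor P E) (g : forall u, {linear V u -> E u}) :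
    Prop :=
  [/\ smod_map 0 g, forall u x, cx_d _ (g u x) = j u (xi u x) &
    forall (Q : modop k predT) (f : mor P Q)
      (h : forall u, {linear V u -> Q u}),
      smod_map 0 h -> (forall u x, cx_d _ (h u x) = f u (xi u x)) ->
      exists2 F : mor E Q,
        eqmor (mor_comp F j) f /\ (forall u x, F u (g u x) = h u x) &
        forall F' : mor E Q,
          eqmor (mor_comp F' j) f -> (forall u x, F' u (g u x) = h u x) ->
          eqmor F' F].

(* [T n] is [t_! t_n M]; as there is no index of dimension < 0, [T (-1)] is   *)
(* initial, that is, zero. The condition on [j] says that it is the step      *)
(* [t_! t_(n-1) M -> t_! t_n M] of the canonical tower.                       *)
Definition minimal (k : fieldType) (M : modop k predT) : Prop :=
  exists (T : int -> modop k predT)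
         (eta : forall n, mor (trunc n M) (trunc n (T n))),
    (forall n, is_left_adjoint_trunc (eta n)) /\
    forall n : nat, exists j : mor (T (n%:Z - 1)) (T n%:Z),
      (forall (u : mtype) (u_lt : dim_le (n%:Z - 1) u) (u_le : dim_le n%:Z u)
          (x : M (full (Idx u_lt))),
        j _ (eta _ (Idx u_lt) x) = eta _ (Idx u_le) x) /\
      exists (V : smod k predT) (xi : forall u, {linear V u -> T (n%:Z - 1) u})
             (g : forall u, {linear V u -> T n%:Z u}),
        attaching_data n%:Z xi /\ is_principal_extension xi j g.

(* Main.v *)
Require Import Defs.
From HB Require Import structures.
From mathcomp Require Import all_boot all_order all_fingroup all_algebra.
From mathcomp Require Import boolp classical_sets.
From mathcomp Require Import zify.
From Stdlib Require Import Relation_Operators.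
(* The name [cycle] is also used for cyclic groups. *)
Import Defs.

(** Morphisms out of a minimal operad behave like maps out of a cell complex:
    they lift strictly along every acyclic fibration, that is, every levelwise
    surjection with acyclic kernel ([lift_minimal]). Indeed, up one step of the
    canonical tower a lift amounts to an equivariant linear choice of primitives
    in the kernel; primitives exist by acyclicity, the choice can be made linear,
    and it is made equivariant by averaging, in characteristic zero.

    Strict lifting gives lifting of homotopies. If [p : X -> Y] is an acyclic
    fibration, so is the map from [X (x) I] to the operad of paths in [Y] with
    lifts of both ends to [X] ([path_boundary_acyclic_fibration]), and a lift
    along that map is a homotopy in [X] with prescribed ends and image. Therefore
    [p] induces a bijection on homotopy classes of morphisms out of a minimal
    operad: it is onto by [lift_minimal] and one-to-one by
    [acyclic_fibration_homotopic_inj].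

    A weak equivalence [rho : Q -> R] need not be surjective, and is replaced by
    its mapping path operad [B], the pullback of [Q] and [R (x) I] over [R]. The
    end point of the path defines an acyclic fibration [p : B -> R], because
    [rho] is a weak equivalence, and the projection [r : B -> Q] is an acyclic
    fibration because paths contract to their starting point. Constant paths
    define [s : Q -> B] with [r s = id] and [p s = rho]. On homotopy classes of
    morphisms out of [M], [r] is bijective, hence so is its section [s], hence so
    is [rho = p s]; this is the theorem. *)

Set Implicit Arguments.
Unset Strict Implicit.
Unset Printing Implicit Defensive.

Import Order.TTheory GRing.Theory Num.Theory.
Local Open Scope ring_scope.

Lemma linear_map_exists (k : fieldType) (V W : lmodType k) (f : V -> W) :
  linear f -> exists g : {linear V -> W}, g =1 f.
Proof.
move=> fl; pose m := GRing.isLinear.Build k V W _ f fl.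
pose g : {linear V -> W} := HB.pack f m.
by exists g.
Qed.

(** * Equivariant sections of linear relations *)

Section GradedSection.
Variables (k : fieldType) (V X : complex k) (S : V -> X -> Prop).
Hypothesis S0 : S 0 0.
Hypothesis S_linear : forall (c : k) v v' x x',
  S v x -> S v' x' -> S (c *: v + v') (c *: x + x').

(** Such a [G] is the graph of a linear map on a graded subspace, or is empty:
    the empty set is admitted because it is the union of the empty chain. *)
Definition partial_section (G : set (V * X)) : Prop :=
  [/\ forall (c : k) p q, G p -> G q -> G (c *: p + q),
      forall i p, G p -> G (cx_pr V i p.1, cx_pr X i p.2),
      forall p, G p -> S p.1 p.2
    & forall x, G (0, x) -> x = 0].

Definition add_line (G : set (V * X)) (p : V * X) : set (V * X) :=
  [set r | exists (c : k) (q : V * X), (G q \/ q = 0) /\ r = c *: p + q].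

(** Adding a homogeneous pair keeps the domain graded; the hypothesis on [c] and
    [q] expresses that the enlarged graph remains single-valued. *)
Lemma add_line_section G i (p : V * X) : partial_section G ->
  homog i p.1 -> homog i p.2 -> S p.1 p.2 ->
  (forall (c : k) q, G q \/ q = 0 -> c *: p.1 + q.1 = 0 ->
     c *: p.2 + q.2 = 0) ->
  partial_section (add_line G p).
Proof.
move=> [Gl Gpr GS G0] p1 p2 pS pf.
have G0' (q : V * X) : G q -> G 0.
  by move=> Gq; have := Gl (-1) _ _ Gq Gq; rewrite scaleN1r addNr.
have Gl' (c : k) (q q' : V * X) : G q \/ q = 0 -> G q' \/ q' = 0 ->
    G (c *: q + q') \/ c *: q + q' = 0.
  move=> [Gq|->] [Gq'|->].
  - by left; apply: Gl.
  - by left; apply: Gl => //; apply: G0' Gq.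
  - by left; rewrite scaler0 add0r.
  - by right; rewrite scaler0 addr0.
split.
- move=> c _ _ [a [q [Gq ->]]] [b [q' [Gq' ->]]].
  exists (c * a + b), (c *: q + q'); split; first exact: Gl'.
  by rewrite scalerDl scalerDr scalerA addrACA.
- move=> j _ [a [q [Gq ->]]] /=.
  exists (if j == i then a else 0), (cx_pr V j q.1, cx_pr X j q.2); split.
    case: Gq => [Gq|->]; first by left; apply: Gpr.
    by right; rewrite !raddf0.
  have H (C : complex k) (x : C) : homog i x ->
      cx_pr C j x = if j == i then x else 0.
    by move=> xi; rewrite -{1}xi cx_prK xi.
  rewrite !linearP /= (H _ _ p1) (H _ _ p2).
  by case: eqP => _; congr (_, _); rewrite /= ?scaler0 ?scale0r.
- move=> _ [a [q [Gq ->]]] /=; apply: S_linear => //.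
  by case: Gq => [/GS|->].
- move=> x [a [q [Gq [/esym e1 e2]]]]; rewrite e2.
  exact: pf Gq e1.
Qed.

(** The source may be infinite-dimensional, so a linear choice requires Zorn's
    lemma: a maximal partial section is defined at every homogeneous vector,
    since otherwise it could be extended to the line through that vector. *)
Lemma graded_section :
  (forall i v, homog i v -> exists2 x, homog i x & S v x) ->
  exists2 h : {linear V -> X},
    forall i v, h (cx_pr V i v) = cx_pr X i (h v) & forall v, S v (h v).
Proof.
move=> S_total.
have [|G [Gsec Gmax]] := @Zorn_bigcup _ partial_section.
  move=> F FP Ftot; split.
  - move=> c p q [A FA Ap] [B FB Bq].
    have [AB|BA] := Ftot _ _ FA FB.
      by exists B => //; have [h _ _ _] := FP _ FB; apply: h => //; apply: AB.
    by exists A => //; have [h _ _ _] := FP _ FA; apply: h => //; apply: BA.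
  - by move=> i p [A FA Ap]; exists A => //; have [_ h _ _] := FP _ FA; apply: h.
  - by move=> p [A FA Ap]; have [_ _ h _] := FP _ FA; apply: h.
  - by move=> x [A FA Ap]; have [_ _ _ h] := FP _ FA; apply: h.
have Gadd i p : homog i p.1 -> homog i p.2 -> S p.1 p.2 ->
    (forall (c : k) q, G q \/ q = 0 -> c *: p.1 + q.1 = 0 ->
       c *: p.2 + q.2 = 0) -> G p.
  move=> p1 p2 pS pf; apply: contrapT => nGp.
  apply: (Gmax (add_line G p)); last exact: (add_line_section Gsec p1 p2 pS pf).
  split=> [|sub]; last first.
    by apply/nGp/sub; exists 1, 0; split; [right|rewrite scale1r addr0].
  by move=> q Gq; exists 0, q; split; [left|rewrite scale0r add0r].
have [Gl Gpr GS Gf] := Gsec.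
have G0 : G 0.
  apply: (Gadd 0) => //=; try exact: homog0.
  move=> c q; rewrite !scaler0 !add0r => -[Gq q0|->//].
  by apply: Gf; rewrite -q0 -surjective_pairing.
have Gfun v x y : G (v, x) -> G (v, y) -> x = y.
  move=> Gx Gy; have := Gl (-1) _ _ Gx Gy.
  rewrite [_ + _]surjective_pairing /= scaleN1r addNr scaleN1r => /Gf /eqP.
  by rewrite addrC subr_eq0 => /eqP.
(* It is enough to reach homogeneous vectors, as they span [V]. *)
have Gdom v : exists x, G (v, x).
  elim/cx_ind: v => [|v w [x Gx] [y Gy]|i v vi].
  - by exists 0.
  - exists (x + y).
    by have := Gl 1 _ _ Gx Gy; rewrite scale1r.
  apply: contrapT => nG; have [x xi Sx] := S_total _ _ vi.
  apply: (nG); exists x; apply: (Gadd i) => //= c q Gq.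
  have {}Gq : G q by case: Gq => [|->].
  have [->|c0] := eqVneq c 0.
    rewrite !scale0r !add0r => q0; apply: Gf.
    by rewrite -q0 -surjective_pairing.
  move=> e; case: nG; exists ((- c^-1) *: q.2).
  have := Gl (- c^-1) _ _ Gq G0; rewrite addr0.
  congr (G (_, _)); move/eqP: e; rewrite addrC addr_eq0 => /eqP /= ->.
  by rewrite scaleNr scalerN opprK scalerA mulVf // scale1r.
have [h0 h0G] := choice Gdom.
have [|h hE] := @linear_map_exists k V X h0.
  move=> c v w; apply: (Gfun (c *: v + w)) => //.
  exact: Gl (h0G v) (h0G w).
exists h => [i v|v]; rewrite !hE; last exact: GS (h0G v).
exact: Gfun (h0G _) (Gpr i _ (h0G v)).
Qed.
End GradedSection.

Section EquivariantSection.
Variables (k : fieldType) (char0 : [pchar k] =i pred0) (D : pred mtype).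
Variables (V X : smod k D) (S : forall u : idx D, V u -> X u -> Prop).
Hypothesis S0 : forall u, @S u 0 0.
Hypothesis S_linear : forall u (c : k) v v' x x',
  @S u v x -> S v' x' -> S (c *: v + v') (c *: x + x').
Hypothesis S_act : forall (u : idx D) (s : 'S_(legs u)) v x,
  S v x -> S (sm_act V s v) (sm_act X s x).
Hypothesis S_total : forall u i v, homog i v -> exists2 x, homog i x & @S u v x.

(** A graded section is averaged over the symmetric group; this is where
    characteristic zero enters, as the order of the group has to be inverted.
    The average stays in [S] because [S] is linear and equivariant. *)
Lemma equivariant_section :
  exists2 h : forall u, {linear V u -> X u},
    smod_map 0 h & forall u v, S v (h u v).
Proof.
have spec : forall u : idx D, exists h : {linear V u -> X u},
    [/\ forall i v, h (cx_pr _ i v) = cx_pr _ i (h v),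
        forall s v, h (sm_act V s v) = sm_act X s (h v) & forall v, S v (h v)].
  move=> u.
  have [h0 h0_pr h0_S] := graded_section (S0 u) (@S_linear u) (@S_total u).
  pose N : k := #|[set: 'S_(legs u)]|%:R.
  have N0 : N != 0.
    rewrite ((pcharf0P k).1 char0) -lt0n; apply/card_gt0P; exists 1%g.
    by rewrite inE.
  pose t (s : 'S_(legs u)) v := sm_act X s^-1%g (h0 (sm_act V s v)).
  have [|h hE] :=
    @linear_map_exists k (V u) (X u) (fun v => N^-1 *: \sum_s t s v).
    move=> c v w; rewrite scalerA mulrC -scalerA -scalerDr; congr (_ *: _).
    by rewrite scaler_sumr -big_split; apply: eq_bigr => s _; rewrite /t !linearP.
  exists h; split.
  - move=> i v; rewrite !hE linearZ_LR; congr (_ *: _); rewrite raddf_sum.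
    by apply: eq_bigr => s _; rewrite /= /t sm_act_pr h0_pr sm_act_pr.
  - move=> r v; rewrite !hE linearZ_LR; congr (_ *: _); rewrite raddf_sum.
    rewrite (reindex_inj (mulIg r^-1%g)); apply: eq_bigr => s _.
    by rewrite /= /t -sm_actM mulgKV invMg invgK sm_actM.
  - move=> v; rewrite hE.
    have : S (N *: v) (\sum_s t s v).
      rewrite /N scaler_nat cardsE -sumr_const.
      elim/big_rec2: _ => // s x y _ Sxy.
      have := S_linear 1 (S_act s^-1%g (h0_S (sm_act V s v))) Sxy.
      by rewrite !scale1r -sm_actM mulVg sm_act1.
    move/(@S_linear _ N^-1) => /(_ 0 0 (S0 u)).
    by rewrite !addr0 scalerA mulVf // scale1r.
pose h u := projT1 (cid (spec u)).
have h_spec u := projT2 (cid (spec u)).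
exists h => [|u v]; last by have [] := h_spec u.
by split=> [u i|u s] x; have [h1 h2 _] := h_spec u; rewrite ?addr0.
Qed.
End EquivariantSection.

(** * Lifting along acyclic fibrations *)

(** This is the surjectivity of [f] together with the acyclicity of its kernel,
    in the form of the lifting problem that a cell of degree [i + 1] attached
    along a cycle [x] presents. *)
Definition acyclic_fibration (k : fieldType) (C D : complex k)
    (f : {linear C -> D}) : Prop :=
  forall (i : int) (x : C) (y : D),
    cycle i x -> homog (i + 1) y -> cx_d D y = f x ->
    exists2 z : C, homog (i + 1) z & cx_d C z = x /\ f z = y.

Lemma mor_homog (k : fieldType) (D : pred mtype) (P Q : modop k D)
    (f : mor P Q) (u : idx D) i (x : P u) : homog i x -> homog i (f u x).
Proof. by rewrite /homog -mor_pr => ->. Qed.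

(** A morphism out of [E] is its restriction to [P] with an equivariant choice
    on [V] of primitives of the attached cycles. For each homogeneous [v] the
    acyclic fibration supplies a primitive of [F (xi v)] above [phi (g v)], and
    [equivariant_section] makes these choices linear and equivariant. *)
Lemma lift_principal_extension (k : fieldType) (char0 : [pchar k] =i pred0)
    (P E X Y : modop k predT) (n : int) (V : smod k predT)
    (xi : forall u, {linear V u -> P u}) (j : mor P E)
    (g : forall u, {linear V u -> E u}) (Phi : mor X Y)
    (F : mor P X) (phi : mor E Y) :
  attaching_data n xi -> is_principal_extension xi j g ->
  (forall u, acyclic_fibration (Phi u)) ->
  eqmor (mor_comp Phi F) (mor_comp phi j) ->
  exists2 F' : mor E X, eqmor (mor_comp F' j) F & eqmor (mor_comp Phi F') phi.
Proof.
move=> [V_d _ [xi_pr xi_act] xi_d] [[g_pr g_act] g_d E_univ] Phi_af Phi_F.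
pose S u (v : V u) (x : X u) :=
  cx_d _ x = F u (xi u v) /\ Phi u x = phi u (g u v).
have [|||u i v vi|h h_smod h_S] := @equivariant_section k char0 predT V X S.
- by move=> u; split; rewrite !raddf0.
- move=> u c v v' x x' [h1 h2] [h3 h4].
  by split; rewrite !linearP ?h1 ?h2 ?h3 ?h4.
- move=> u s v x [h1 h2].
  by split; rewrite ?xi_act ?g_act !mor_act -?sm_act_d ?h1 ?h2.
- have [|||z zi [h1 h2]] := Phi_af u (i - 1) (F u (xi u v)) (phi u (g u v)).
  + split; last by rewrite -mor_d xi_d raddf0.
    by apply: mor_homog; rewrite /homog -xi_pr vi.
  + rewrite subrK; apply: mor_homog.
    by rewrite /homog -[X in cx_pr _ X]addr0 -g_pr vi.
  + by rewrite -mor_d g_d; have := Phi_F u (xi u v).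
  by exists z; rewrite // -[i](subrK 1).
have [F' [F'j F'g] _] :=
  E_univ X F h h_smod (fun u x => (h_S u x).1).
exists F' => //.
pose hY u : {linear V u -> Y u} := (phi u \o g u : {linear _ -> _}).
have [||G _ G_uniq] := E_univ Y (mor_comp phi j) hY.
- split=> [u i x|u s x] /=; first by rewrite g_pr mor_pr.
  by rewrite g_act mor_act.
- by move=> u x /=; rewrite -mor_d g_d.
move=> u x; rewrite (G_uniq phi) //.
apply: G_uniq => {}u {}x /=.
  by rewrite -[RHS]Phi_F /= -[in RHS]F'j.
by rewrite F'g (h_S u x).2.
Qed.

(** * Morphisms out of a minimal operad *)

Section IdxTotal.
Variable K : idx predT -> Type.

(** Truncations only see the indices of the form [full u], whose proof component
    is [isT]; families on those extend to all indices. *)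
Definition idx_total (f : forall u : mtype, K (@Idx predT u isT))
    (u : idx predT) : K u :=
  let: Idx u p := u in
  match bool_irrelevance (isT : predT u) p in _ = q return K (@Idx predT u q)
  with erefl => f u end.

Lemma idx_totalE f u : idx_total f (@Idx predT u isT) = f u.
Proof.
by rewrite /idx_total (_ : bool_irrelevance _ _ = erefl).
Qed.
End IdxTotal.

Section Glueing.
Variables (k : fieldType) (M X : modop k predT).
Variable G : forall n : nat, mor (trunc n%:Z M) (trunc n%:Z X).
Hypothesis G_compat : forall n (u : mtype) (hn : dim_le n%:Z u)
  (hn1 : dim_le n.+1%:Z u) (x : M (@Idx predT u isT)), G n (Idx hn) x = G n.+1 (Idx hn1) x.

Let level (u : mtype) : nat := (3 * genus u + legs u)%N.

Let dim_le_level u n : (level u <= n)%N -> dim_le n%:Z u.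
Proof. rewrite /dim_le /dim /level /=; lia. Qed.

Let G_compat_le m n (u : mtype) (hm : dim_le m%:Z u) (hn : dim_le n%:Z u)
    (x : M (@Idx predT u isT)) :
  (m <= n)%N -> G m (Idx hm) x = G n (Idx hn) x.
Proof.
elim: n hn => [|n IHn] hn; first by case: m hm x => // hm x _;
  rewrite (bool_irrelevance hm hn).
rewrite leq_eqVlt => /predU1P[mn|mn].
  by clear IHn; move: hm; rewrite mn => hm; rewrite (bool_irrelevance hm hn).
have hn' : dim_le n%:Z u by move: (hm) mn; rewrite /dim_le /=; lia.
by rewrite (IHn hn') // G_compat.
Qed.

(** Each axiom of a morphism involves finitely many components, so it can be
    checked in a truncation that is large enough. *)
Lemma glue_mor : exists f : mor M X, forall n, eqmor (trunc_mor n%:Z f) (G n).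
Proof.
pose f := @idx_total (fun u => {linear M u -> X u})
  (fun u => G (level u) (Idx (dim_le_level (leqnn (level u))))).
have fE n (u : mtype) (hn : dim_le n%:Z u)
      (x : M (@Idx predT u isT)) :
    f (@Idx predT u isT) x = G n (Idx hn) x.
  rewrite /f idx_totalE; case: (leqP (level u) n) => [|/ltnW] un.
    exact: G_compat_le.
  by apply/esym/G_compat_le.
have Kind (K : idx predT -> Prop) : (forall u, K (@Idx predT u isT)) ->
  forall u, K u by exact: idx_total.
have f_pr u i x : f u (cx_pr _ i x) = cx_pr _ i (f u x).
  elim/Kind: u x => u x; have hu := dim_le_level (leqnn (level u)).
  by rewrite !(fE _ _ hu); exact: (mor_pr (G _) (u := Idx hu)).
have f_d u x : f u (cx_d _ x) = cx_d _ (f u x).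
  elim/Kind: u x => u x; have hu := dim_le_level (leqnn (level u)).
  by rewrite !(fE _ _ hu); exact: (mor_d (G _) (u := Idx hu)).
have f_act (u : idx predT) (s : 'S_(legs u)) x :
    f u (sm_act M s x) = sm_act X s (f u x).
  elim/Kind: u s x => u s x; have hu := dim_le_level (leqnn (level u)).
  by rewrite !(fE _ _ hu); exact: (mor_act (G _) (u := Idx hu)).
have f_comp (u v w : idx predT) (e : glue u v w) i a b :
    f w (op_comp M e i a b) = op_comp X e i (f u a) (f v b).
  elim/Kind: u e i a => u; elim/Kind: v b => v; elim/Kind: w => w b e i a.
  pose N := (level u + level v + level w)%N.
  have hu : dim_le N%:Z u by apply: dim_le_level; rewrite /N; lia.
  have hv : dim_le N%:Z v by apply: dim_le_level; rewrite /N; lia.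
  have hw : dim_le N%:Z w by apply: dim_le_level; rewrite /N; lia.
  rewrite (fE _ _ hu) (fE _ _ hv) (fE _ _ hw).
  exact: (mor_op_comp (G N) (u := Idx hu) (v := Idx hv) (w := Idx hw)).
have f_contr (u w : idx predT) (i j : 'I_(legs u)) (ij : i != j)
    (e : selfglue u w) a : f w (op_contr M ij e a) = op_contr X ij e (f u a).
  elim/Kind: u i j ij e a => u; elim/Kind: w => w i j ij e a.
  pose N := (level u + level w)%N.
  have hu : dim_le N%:Z u by apply: dim_le_level; rewrite /N; lia.
  have hw : dim_le N%:Z w by apply: dim_le_level; rewrite /N; lia.
  rewrite (fE _ _ hu) (fE _ _ hw).
  exact: (mor_op_contr (G N) (u := Idx hu) (w := Idx hw)).
exists (Mor f_pr f_d f_act f_comp f_contr) => n [u hu] x /=.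
exact: fE.
Qed.
End Glueing.

(** The two ends [m] and [n] are independent, so that [n.+1 - 1] can be replaced
    by [n] in the types of the consecutive steps. *)
Definition is_tower_step (k : fieldType) (M : modop k predT)
    (T : int -> modop k predT)
    (eta : forall n, mor (trunc n M) (trunc n (T n))) (m n : int) : Prop :=
  exists j : mor (T m) (T n),
    (forall (u : mtype) (u_lt : dim_le m u) (u_le : dim_le n u)
        (x : M (full (Idx u_lt))),
      j _ (eta _ (Idx u_lt) x) = eta _ (Idx u_le) x) /\
    exists (V : smod k predT) (xi : forall u, {linear V u -> T m u})
           (g : forall u, {linear V u -> T n u}),
      attaching_data n xi /\ is_principal_extension xi j g.

(** By stability there is nothing below modular dimension 0, so that the tower
    starts from an initial object. *)
Lemma dim_ge0 (u : mtype) : 0 <= dim u.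
Proof. by rewrite /dim; have := mtype_stable u; lia. Qed.

Lemma no_neg_idx (u : idx (dim_le (-1))) : False.
Proof.
by have := idx_in u; have := dim_ge0 u; rewrite /dim_le /=; lia.
Qed.

Definition neg_mor (k : fieldType) (P Q : modop k (dim_le (-1))) : mor P Q.
Proof.
by refine (@Mor _ _ P Q (fun u => False_rect _ (no_neg_idx u)) _ _ _ _ _) => u;
  case: (no_neg_idx u).
Defined.

Section LiftMinimal.
Variables (k : fieldType) (char0 : [pchar k] =i pred0).
Variables (M X Y : modop k predT) (Phi : mor X Y).
Hypothesis Phi_af : forall u, acyclic_fibration (Phi u).

(** The lift is built up the canonical tower, one principal extension at a time.
    A morphism [psi] is then recovered from its values on [T n], because
    [eta n] relates [M] and [T n] in modular dimensions at most [n]. *)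
Lemma lift_minimal : minimal M -> forall phi : mor M Y,
  exists psi : mor M X, eqmor (mor_comp Phi psi) phi.
Proof.
move=> [T [eta [adj steps]]] phi.
(* [phiT n] is the composite of the counit [T n -> M] with [phi]. *)
have phi_ex n : exists f : mor (T n) Y,
    eqmor (mor_comp (trunc_mor n f) (eta n)) (trunc_mor n phi).
  by have [f fE _] := adj n Y (trunc_mor n phi); exists f.
pose phiT n := projT1 (cid (phi_ex n)).
have phiT_eta n (u : mtype) (hn : dim_le n u) (x : M (@Idx predT u isT)) :
    phiT n (@Idx predT u isT) (eta n (Idx hn) x) = phi (@Idx predT u isT) x.
  exact: (projT2 (cid (phi_ex n)) (Idx hn) x).
have {}steps (n : nat) : is_tower_step eta (n%:Z - 1) n%:Z by exact: steps.
have lift_step m n (F : mor (T m) X) : m <= n -> is_tower_step eta m n ->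
    eqmor (mor_comp Phi F) (phiT m) ->
    exists F' : mor (T n) X, eqmor (mor_comp Phi F') (phiT n) /\
      forall (u : mtype) (hm : dim_le m u) (hn : dim_le n u)
        (x : M (@Idx predT u isT)),
        F' (@Idx predT u isT) (eta n (Idx hn) x) =
        F (@Idx predT u isT) (eta m (Idx hm) x).
  move=> mn [j [j_eta [V [xi [g [att pe]]]]]] FE.
  have phiT_j : eqmor (mor_comp (phiT n) j) (phiT m).
    (* Both are adjoint to the truncation of [phi]. *)
    have [f _ f_uniq] := adj m Y (trunc_mor m phi).
    have jE : eqmor (mor_comp (phiT n) j) f.
      apply: f_uniq => -[u hm] x.
      have hn : dim_le n u by move: (hm); rewrite /dim_le /=; lia.
      by rewrite /= -[RHS](phiT_eta n u hn) -(j_eta u hm hn).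
    have mE : eqmor (phiT m) f by apply: f_uniq => -[u hm] x; exact: phiT_eta.
    by move=> u x; rewrite jE mE.
  have [|F' F'j F'E] := lift_principal_extension (F := F) (phi := phiT n) char0
    att pe Phi_af.
    by move=> u x; rewrite FE phiT_j.
  exists F'; split=> // u hm hn x.
  by rewrite -[LHS]/(F' _ _) -(j_eta u hm hn) -[RHS]F'j.
have [F0 F0E] : exists F : mor (T 0) X, eqmor (mor_comp Phi F) (phiT 0).
  have [F _ _] := adj (-1) X (neg_mor _ _).
  have FE : eqmor (mor_comp Phi F) (phiT (-1)).
    have [f' _ f'_uniq] := adj (-1) Y (trunc_mor (-1) phi).
    by move=> u x; rewrite (f'_uniq (mor_comp Phi F)) ?(f'_uniq (phiT (-1))) //;
       move=> v; case: (no_neg_idx v).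
  by have [//|F' [F'E _]] := lift_step (-1) 0 F _ (steps 0%N) FE; exists F'.
pose stage (n : nat) := {F : mor (T n%:Z) X | eqmor (mor_comp Phi F) (phiT n%:Z)}.
have next (n : nat) (F : stage n) : {F' : stage n.+1 |
    forall (u : mtype) (hn : dim_le n%:Z u) (hn1 : dim_le n.+1%:Z u)
      (x : M (@Idx predT u isT)),
      sval F' (@Idx predT u isT) (eta _ (Idx hn1) x) =
      sval F (@Idx predT u isT) (eta _ (Idx hn) x)}.
  apply/cid; case: F => F FE /=.
  have nn1 : n.+1%:Z - 1 = n%:Z by lia.
  have := steps n.+1; rewrite nn1 => st.
  have [|F' [F'E F'F]] := lift_step _ _ F _ st FE; first by lia.
  by exists (exist _ F' F'E).
pose F := nat_rect stage (exist _ F0 F0E) (fun n G => sval (next n G)).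
have FS n := svalP (next n (F n)).
have [|psi psiE] := @glue_mor k M X
  (fun n => mor_comp (trunc_mor n%:Z (sval (F n))) (eta n%:Z)).
  by move=> n u hn hn1 x; apply/esym/FS.
exists psi; apply: idx_total => u x.
have [n hn] : exists n : nat, dim_le n%:Z u.
  by exists `|dim u|%N; rewrite /dim_le /=; have := dim_ge0 u; lia.
have /= -> := psiE n (Idx hn) x.
by rewrite -(phiT_eta n%:Z u hn x) -[RHS](svalP (F n)).
Qed.
End LiftMinimal.

(** * Pullbacks of modular operads *)

Section Pullback.
Variables (k : fieldType) (D : pred mtype) (A B C : modop k D).
Variables (f : mor A C) (g : mor B C).

Definition pullback_pred (u : idx D) : {pred (A u * B u)%type} :=
  [pred x | f u x.1 == g u x.2].
Arguments pullback_pred u : clear implicits.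

Lemma pullback_submod u : submod_closed (pullback_pred u).
Proof.
split=> [|c x y /eqP xE /eqP yE]; rewrite !inE /= ?raddf0 //.
by rewrite !linearP xE yE.
Qed.

HB.instance Definition _ u := GRing.isSubmodClosed.Build k (A u * B u)%type
  (pullback_pred u) (pullback_submod u).

Record pullback (u : idx D) := Pullback {
  pullback_val : (A u * B u)%type;
  pullback_valP : pullback_val \in pullback_pred u
}.

HB.instance Definition _ u := [isSub for @pullback_val u].
HB.instance Definition _ u := [Choice of pullback u by <:].
HB.instance Definition _ u := [SubChoice_isSubLmodule of pullback u by <:].

Definition pb1 u (x : pullback u) : A u := (val x).1.
Definition pb2 u (x : pullback u) : B u := (val x).2.

Lemma pbP u (x y : pullback u) : pb1 x = pb1 y -> pb2 x = pb2 y -> x = y.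
Proof.
by move=> h1 h2; apply: val_inj; rewrite [val x]surjective_pairing
  [val y]surjective_pairing; congr (_, _).
Qed.

Lemma pb_eq u (x : pullback u) : f u (pb1 x) = g u (pb2 x).
Proof. exact/eqP/(valP x). Qed.

Lemma pair_in_pb u (a : A u) (b : B u) : f u a = g u b ->
  (a, b) \in pullback_pred u.
Proof. by move=> e; apply/eqP. Qed.

Definition mkpb u (a : A u) (b : B u) (e : f u a = g u b) : pullback u :=
  Pullback (pair_in_pb e).

Lemma pb1_linear u : linear (@pb1 u). Proof. by []. Qed.
Lemma pb2_linear u : linear (@pb2 u). Proof. by []. Qed.
HB.instance Definition _ u :=
  GRing.isLinear.Build k (pullback u) (A u) _ (@pb1 u) (@pb1_linear u).
HB.instance Definition _ u :=
  GRing.isLinear.Build k (pullback u) (B u) _ (@pb2 u) (@pb2_linear u).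

(* Differentials, projections onto degrees, actions and contractions of the
   pullback are all induced by pairs of linear maps that agree over [C]. *)
Section Map.
Variables (u v : idx D) (a : {linear A u -> A v}) (b : {linear B u -> B v}).
Variable c : {linear C u -> C v}.
Hypothesis fa : forall x, f v (a x) = c (f u x).
Hypothesis gb : forall x, g v (b x) = c (g u x).

Lemma pb_map_eq (x : pullback u) : f v (a (pb1 x)) = g v (b (pb2 x)).
Proof. by rewrite fa gb pb_eq. Qed.
Definition pb_map x : pullback v := mkpb (pb_map_eq x).
Lemma pb_map_linear : linear pb_map.
Proof. by move=> e x y; apply: pbP; rewrite /pb1 /pb2 /= linearP. Qed.
HB.instance Definition _ :=
  GRing.isLinear.Build k (pullback u) (pullback v) _ pb_map pb_map_linear.
End Map.

Definition pb_pr u i := pb_map (mor_pr f (u := u) i) (mor_pr g (u := u) i).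
Definition pb_d u := pb_map (mor_d f (u := u)) (mor_d g (u := u)).

Lemma pb_fin u (x : pullback u) : exists2 s : seq int,
  uniq s & x = \sum_(i <- s) pb_pr i x.
Proof.
have [s _ sx] := cx_supp (pb1 x); have [t _ tx] := cx_supp (pb2 x).
have us := undup_uniq (s ++ t).
exists (undup (s ++ t)) => //; apply: pbP; rewrite raddf_sum.
  by apply: sx => // i si; rewrite mem_undup mem_cat si.
by apply: tx => // i ti; rewrite mem_undup mem_cat ti orbT.
Qed.

Definition pb_cx (u : idx D) : complex k.
Proof.
refine (@Complex k (pullback u) (@pb_pr u) (@pb_d u) _ (@pb_fin u) _ _).
- by move=> i j x; apply: pbP; apply: etrans (cx_prK _ _ _) _; case: eqP.
- by move=> i x; apply: pbP; apply: cx_prd.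
- by move=> x; apply: pbP; apply: cx_dd.
Defined.

Definition pb_smod : smod k D.
Proof.
refine (@Smod k D pb_cx (fun u s => pb_map (mor_act f s) (mor_act g s)) _ _ _ _).
- by move=> u s i x; apply: pbP; apply: sm_act_pr.
- by move=> u s x; apply: pbP; apply: sm_act_d.
- by move=> u x; apply: pbP; apply: sm_act1.
- by move=> u s t x; apply: pbP; apply: sm_actM.
Defined.

Lemma pb_comp_eq (u v w : idx D) (e : glue u v w) i (x : pullback u)
    (y : pullback v) :
  f w (op_comp A e i (pb1 x) (pb1 y)) = g w (op_comp B e i (pb2 x) (pb2 y)).
Proof. by rewrite !mor_op_comp !pb_eq. Qed.

Definition pb_comp (u v w : idx D) (e : glue u v w) i (x : pullback u)
  (y : pullback v) : pullback w := mkpb (pb_comp_eq e i x y).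

Lemma pb_homog u i (x : pb_cx u) :
  homog i x <-> homog i (pb1 x) /\ homog i (pb2 x).
Proof.
split=> [xi|[h1 h2]]; last exact: pbP.
by split; rewrite /homog -[in RHS]xi.
Qed.

Definition pb_op : modop k D.
Proof.
refine (@Modop k D pb_smod pb_comp
  (fun u w i j ij e => pb_map (mor_op_contr f ij e) (mor_op_contr g ij e))
  _ _ _ _ _ _ _ _ _ _ _ _ _ _ _).
- by move=> u v w e i b c x y; apply: pbP; apply: op_compl.
- by move=> u v w e i a c x y; apply: pbP; apply: op_compr.
- move=> u v w e i p q a b /pb_homog[a1 a2] /pb_homog[b1 b2].
  by apply/pb_homog; split; apply: op_comp_homog.
- by move=> u v w e i p a b /pb_homog[a1 a2]; apply: pbP; apply: op_comp_d.
- by move=> *; apply: pbP; apply: op_contr_pr.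
- by move=> *; apply: pbP; apply: op_contr_d.
- by move=> *; apply: pbP; apply: op_comp_act.
- by move=> *; apply: pbP; apply: op_contr_act.
- move=> u v w e e' i j r p q a b h1 h2 h3 h4 /pb_homog[a1 a2] /pb_homog[b1 b2].
  by apply: pbP; apply: op_compC h1 h2 h3 h4 _ _.
- move=> u v w uv vw z e1 e2 e3 e4 i j j' a b c h1 h2.
  by apply: pbP; apply: op_compA h1 h2.
- move=> u v w uv uw z e1 e2 e3 e4 i j j' i' p q a b c h1 h2 h3.
  move=> /pb_homog[b1 b2] /pb_homog[c1 c2].
  by apply: pbP; apply: op_compAC h1 h2 h3 _ _.
- by move=> *; apply: pbP; apply: op_contr_sym.
- move=> u v v' w e1 e2 e3 e4 i j l m l' m' i' j' ij lm lm' ij' a h1 h2 h3 h4 h5.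
  by apply: pbP; apply: op_contrAC h1 h2 h3 h4 h5.
- move=> u v uv u' w e1 e2 e3 e4 l i j i' j' l' ij ij' a b h1 h2 h3 h4 h5.
  by apply: pbP; apply: op_contr_comp h1 h2 h3 h4 h5.
- move=> u v uv w e1 e2 l i z j i1 j1 l2 j2 ij lj r a b.
  move=> h1 h2 h3 h4 h5 h6 h7 h8 h9.
  by apply: pbP; apply: op_contr_comp2 h1 h2 h3 h4 h5 h6 h7 h8 h9.
Defined.

Lemma pb1_d u (x : pb_op u) : pb1 (cx_d (pb_op u) x) = cx_d (A u) (pb1 x).
Proof. by []. Qed.
Lemma pb2_d u (x : pb_op u) : pb2 (cx_d (pb_op u) x) = cx_d (B u) (pb2 x).
Proof. by []. Qed.

Definition pb_fst : mor pb_op A.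
Proof. by refine (@Mor k D pb_op A (fun u => @pb1 u) _ _ _ _ _). Defined.

Definition pb_snd : mor pb_op B.
Proof. by refine (@Mor k D pb_op B (fun u => @pb2 u) _ _ _ _ _). Defined.

Section Pairing.
Variables (M : modop k D) (a : mor M A) (b : mor M B).
Hypothesis ab : eqmor (mor_comp f a) (mor_comp g b).

Definition pb_pair_fun u (x : M u) : pullback u := mkpb (ab (u := u) x).
Lemma pb_pair_linear u : linear (@pb_pair_fun u).
Proof. by move=> c x y; apply: pbP; rewrite /pb1 /pb2 /= linearP. Qed.
HB.instance Definition _ u := GRing.isLinear.Build k (M u) (pullback u) _
  (@pb_pair_fun u) (@pb_pair_linear u).

Definition pb_pair : mor M pb_op.
Proof.
refine (@Mor k D M pb_op (fun u => @pb_pair_fun u) _ _ _ _ _).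
- by move=> u i x; apply: pbP; apply: mor_pr.
- by move=> u x; apply: pbP; apply: mor_d.
- by move=> u s x; apply: pbP; apply: mor_act.
- by move=> u v w e i x y; apply: pbP; apply: mor_op_comp.
- by move=> u w i j ij e x; apply: pbP; apply: mor_op_contr.
Defined.

Lemma pb1_pair u x : pb1 (pb_pair u x) = a u x. Proof. by []. Qed.
Lemma pb2_pair u x : pb2 (pb_pair u x) = b u x. Proof. by []. Qed.
End Pairing.
End Pullback.

(** * Path objects *)

Section TensIFunctor.
Variables (k : fieldType) (D : pred mtype).

Definition const_mor (P : modop k D) : mor P (tensI_op P).
Proof.
refine (@Mor k D P (tensI_op P) (fun u => @mI k (P u) 0) _ _ _ _ _).
- by move=> u i x; apply/esym/tensI_pr_mI.
- by move=> u x; apply/esym/(etrans (tensI_d_mI _ _)); rewrite scale0r addr0.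
- by move=> u s x; apply/esym/act_m.
- by move=> u v w e i a b; apply/esym/comp_mm.
- by move=> u w i j ij e a; apply/esym/contr_m.
Defined.

Variables (P Q : modop k D) (f : mor P Q).

Definition tensI_mor : mor (tensI_op P) (tensI_op Q).
Proof.
refine (@Mor k D (tensI_op P) (tensI_op Q) (fun u => @tensI_map k _ _ (f u))
  _ _ _ _ _).
- by move=> u i x; apply: tensI_map_pr => {}i {}x; apply: mor_pr.
- by move=> u x; apply: tensI_map_d => [i {}x|{}x]; [apply: mor_pr|apply: mor_d].
- by move=> u s x; congr (_, _); apply/vpolyP => n /=; apply: mor_act.
- have gs v (x : P v) : f v (gsign x) = gsign (f v x).
    by apply: gsign_map => i {}x; apply: mor_pr.
  move=> u v w e i a b; congr (_, _); apply/vpolyP => n /=.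
    by rewrite raddf_sum; apply: eq_bigr => l _; apply: mor_op_comp.
  rewrite /GRing.add /= /GRing.add /= raddfD !raddf_sum /=.
  congr (_ + _); apply: eq_bigr => l _; rewrite /= mor_op_comp //.
  by rewrite gs.
- by move=> u w i j ij e a; congr (_, _); apply/vpolyP => n /=;
  apply: mor_op_contr.
Defined.
End TensIFunctor.

Section TensIEval.
Variables (k : fieldType) (C : complex k).

Lemma evI_mI (c : k) a (v : C) : evI c (mI a v) = c ^+ a *: v.
Proof. exact: vev_mono. Qed.

Lemma evI_d (c : k) (x : tensI C) : evI c (cx_d _ x) = cx_d _ (evI c x).
Proof. exact: vev_vmap. Qed.

Lemma evID (c : k) (x y : tensI C) : evI c (x + y) = evI c x + evI c y.
Proof. exact: raddfD. Qed.

Lemma evI_homog (c : k) i (x : tensI C) : homog i x -> homog i (evI c x).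
Proof. by rewrite /homog => xi; rewrite -[in RHS]xi; apply/esym/vev_vmap. Qed.

Lemma evI0E (x : tensI C) : evI 0 x = x.1 0%N.
Proof.
have /vfinP[N xN] := vcoef_fin x.1.
rewrite /evI (@vevE _ _ _ _ N.+1) => [|n /ltnW]; last exact: xN.
rewrite big_ord_recl big1 ?addr0 ?expr0 ?scale1r // => i _.
by rewrite expr0n /= scale0r.
Qed.
End TensIEval.

Lemma homogB (k : fieldType) (C : complex k) i (x y : C) :
  homog i x -> homog i y -> homog i (x - y).
Proof. by move=> xi yi; rewrite -scaleN1r; apply/homogD/homogZ. Qed.

Lemma evI_map (k : fieldType) (C E : complex k) (f : {linear C -> E}) (c : k)
  (x : tensI C) : evI c (tensI_map f x) = f (evI c x).
Proof. exact: vev_vmap. Qed.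

Section Antiderivative.
Variables (k : fieldType) (char0 : [pchar k] =i pred0).

Lemma vint_fin (V : lmodType k) (p : vpoly V) :
  (fun n => if n is m.+1 then (m.+1%:R)^-1 *: p m else 0) \in @vfin k V.
Proof.
have /vfinP[N pN] := vcoef_fin p.
by apply/vfinP; exists N.+1 => -[|n] // /pN ->; rewrite scaler0.
Qed.
(** The primitive that vanishes at 0. *)
Definition vint (V : lmodType k) (p : vpoly V) : vpoly V := VPoly (vint_fin p).

(** Paths contract to their starting point: if [y = a + b dt] is a cycle, the
    integral of [b] from 0 to [t], with the Koszul sign, is a primitive of
    [y - y(0)] that vanishes at 0. *)
Lemma eval0_acyclic_fibration (C : complex k) : acyclic_fibration (@evI k C 0).
Proof.
move=> i y c [yi dy] ci /= dc.
pose z : tensI C := (vmap (@gsign k C) (vint y.2), 0).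
have y1i n : homog i (y.1 n) by rewrite /homog -[in RHS]yi.
have y2i n : homog (i + 1) (y.2 n) by rewrite /homog -[in RHS]yi.
have dy2 n : cx_d C (y.2 n) = - (n.+1%:R *: gsign (y.1 n.+1)).
  apply/eqP; rewrite -addr_eq0; apply/eqP.
  have e := congr1 (fun w : vpoly C * vpoly C => w.2 n) dy. exact: e.
have N0 n : n.+1%:R != 0 :> k by rewrite ((pcharf0P k).1 char0).
exists (z + mI 0 c).
  apply: homogD; last exact: mI_homog.
  congr (_, _); last by rewrite raddf0.
  apply/vpolyP => -[|n] /=; rewrite -gsign_pr ?raddf0 // linearZ_LR.
  congr (gsign (_ *: _)).
  exact: y2i.
split; last first.
  by rewrite raddfD /= evI_mI expr0 scale1r evI0E /= raddf0 add0r.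
rewrite raddfD /= tensI_d_mI scale0r addr0 dc evI0E.
have -> : y = (y.1, y.2) by case: (y).
congr (_, _); apply/vpolyP => n.
  transitivity (cx_d C (gsign (vint y.2 n)) + (mI 0 (y.1 0%N)).1 n); first by [].
  case: n => [|n] /=; first by rewrite !raddf0 add0r.
  rewrite !linearZ_LR addr0 -[cx_d C _]opprK -gsign_d dy2 !raddfN /= opprK.
  by rewrite (linearZ_LR (@gsign k C)) /= gsignK scalerA mulVf // scale1r.
transitivity (cx_d C 0 + n.+1%:R *: gsign (gsign (vint y.2 n.+1)) + 0).
  by [].
by rewrite raddf0 add0r addr0 gsignK /= scalerA mulfV // scale1r.
Qed.

(** First lift [d y] to a cycle, then [y] to a primitive of that cycle. *)
Lemma acyclic_fibration_surj (C E : complex k) (p : {linear C -> E}) :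
  (forall x, p (cx_d C x) = cx_d E (p x)) -> acyclic_fibration p ->
  forall i y, homog i y -> exists2 x, homog i x & p x = y.
Proof.
move=> p_d p_af i y yi.
have dyi : homog (i - 2 + 1) (cx_d E y).
  by apply: homog_d; rewrite -addrA (_ : 1 + 1 = 2) // subrK.
have [||x xi [dx px]] := p_af (i - 2) 0 (cx_d E y) _ dyi.
- by split; [apply: homog0|rewrite raddf0].
- by rewrite cx_dd raddf0.
have [|||z zi [dz pz]] := p_af (i - 1) x y.
- by split=> //; rewrite (_ : i - 1 = i - 2 + 1) // -addrA.
- by rewrite subrK.
- by [].
by exists z; rewrite // -[i](subrK 1).
Qed.

Lemma tensI_map_surj (C E : complex k) (p : {linear C -> E}) :
  (forall i y, homog i y -> exists2 x, homog i x & p x = y) ->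
  forall i (y : tensI E), homog i y ->
    exists2 x : tensI C, homog i x & tensI_map p x = y.
Proof.
move=> p_surj i y; elim/tensI_hind => [|y1 y2 [x1 h1 <-] [x2 h2 <-]|a v|a v].
- by exists 0; [apply: homog0|rewrite raddf0].
- by exists (x1 + x2); [apply: homogD|rewrite raddfD].
- move=> /p_surj[x xi <-]; exists (mI a x); first exact: mI_homog.
  exact: tensI_map_mI.
- move=> /p_surj[x xi <-]; exists (mdI a x); first exact: mdI_homog.
  exact: tensI_map_mdI.
Qed.

Section PathObject.
Variables (C E : complex k) (p : {linear C -> E}).
Hypothesis p_pr : forall i x, p (cx_pr C i x) = cx_pr E i (p x).
Hypothesis p_d : forall x, p (cx_d C x) = cx_d E (p x).
Hypothesis p_af : acyclic_fibration p.

Let tp_d (x : tensI C) : tensI_map p (cx_d _ x) = cx_d _ (tensI_map p x).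
Proof. exact: tensI_map_d. Qed.

Let tp_D (x y : tensI C) :
  tensI_map p (x + y) = tensI_map p x + tensI_map p y.
Proof. exact: raddfD. Qed.

(** An arbitrary lift is corrected by the affine path with the same ends, which
    lies in the kernel of [p]. *)
Lemma lift_path_vanishing_ends i (w : tensI E) : homog i w ->
  evI 0 w = 0 -> evI 1 w = 0 ->
  exists2 x : tensI C, homog i x &
    [/\ evI 0 x = 0, evI 1 x = 0 & tensI_map p x = w].
Proof.
move=> wi w0 w1.
have [x xi px] := tensI_map_surj (acyclic_fibration_surj p_d p_af) wi.
exists (x - mI 0 (evI 0 x) - mI 1 (evI 1 x - evI 0 x)).
  apply: homogB; first apply: homogB => //; apply/mI_homog; try exact: evI_homog.
  by apply: homogB; apply: evI_homog.
split.
- rewrite 2!(raddfB (@evI k C 0)) /= !evI_mI expr0 expr1 scale1r scale0r.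
  by rewrite subrr subr0.
- by rewrite 2!(raddfB (@evI k C 1)) /= !evI_mI !expr1n !scale1r subrr.
rewrite 2!(raddfB (tensI_map p)) /= !tensI_map_mI (raddfB p) /= -!(evI_map p) px.
by rewrite w0 w1 !(raddf0, subr0).
Qed.

(** This is the pushout-product property for the inclusion of the two ends of the
    interval: paths in [C] map by an acyclic fibration to paths in [E] with lifts
    of both ends. Paths lift from their starting point by
    [eval0_acyclic_fibration], and what remains is a closed path [G] from 0 to
    [p delta]. It is [d s] with [s] starting at 0; a lift [b] of the end of [s]
    with [d b = delta] makes [d (b t)] a closed path with the right ends, and
    the error is the differential of a path which vanishes at both ends. *)
Lemma path_object_acyclic_fibration i (x : tensI C) (f0 f1 : C) (H : tensI E) :
  cycle i x -> homog (i + 1) f0 -> homog (i + 1) f1 -> homog (i + 1) H ->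
  cx_d C f0 = evI 0 x -> cx_d C f1 = evI 1 x ->
  cx_d _ H = tensI_map p x -> evI 0 H = p f0 -> evI 1 H = p f1 ->
  exists2 z : tensI C, homog (i + 1) z &
    [/\ cx_d _ z = x, evI 0 z = f0, evI 1 z = f1 & tensI_map p z = H].
Proof.
move=> xcyc f0i f1i Hi df0 df1 dH H0 H1.
have [x1 x1i [dx1 x10]] := eval0_acyclic_fibration xcyc f0i df0.
have p_homog j (y : C) : homog j y -> homog j (p y).
  by rewrite /homog => yj; rewrite -p_pr yj.
have tp_homog j (y : tensI C) : homog j y -> homog j (tensI_map p y).
  rewrite /homog => yj; rewrite -[in RHS]yj; exact/esym/tensI_map_pr.
pose delta := f1 - evI 1 x1; pose G := H - tensI_map p x1.
have deltaC : cycle (i + 1) delta.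
  split; first by apply: homogB => //; apply: evI_homog.
  by rewrite raddfB /= -evI_d dx1 df1 subrr.
have GC : cycle (i + 1) G.
  split; first by apply: homogB => //; apply: tp_homog.
  by rewrite raddfB /= -tp_d dx1 dH subrr.
have G0 : evI 0 G = 0 by rewrite raddfB /= evI_map H0 x10 subrr.
have G1 : evI 1 G = p delta by rewrite !raddfB /= evI_map H1.
have [s si [ds s0]] := @eval0_acyclic_fibration E _ _ 0 GC (homog0 _ _)
  (etrans (raddf0 _) (esym G0)).
have [b bi [db pb]] : exists2 b, homog (i + 1 + 1) b &
    cx_d C b = delta /\ p b = evI 1 s.
  by apply: p_af => //; [apply: evI_homog|rewrite -evI_d ds].
have [W Wi [W0 W1 pW]] : exists2 W : tensI C, homog (i + 1 + 1) W &
    [/\ evI 0 W = 0, evI 1 W = 0 & tensI_map p W = s - mI 1 (evI 1 s)].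
  apply: lift_path_vanishing_ends.
  - by apply: homogB => //; apply/mI_homog/evI_homog.
  - by rewrite raddfB /= evI_mI expr1 scale0r s0 subr0.
  - by rewrite raddfB /= evI_mI expr1 scale1r subrr.
exists (x1 + cx_d _ (mI 1 b : tensI C) + cx_d _ W).
  by do 2?[apply: homogD => //]; apply: homog_d => //; apply: mI_homog.
split.
- by rewrite !(raddfD (cx_d (tensI C))) /= !(@cx_dd k (tensI C)) !addr0.
- by rewrite !evID !evI_d W0 evI_mI expr1 scale0r !raddf0 !addr0.
- rewrite !evID !evI_d W1 evI_mI expr1 scale1r raddf0 addr0 db.
  by rewrite addrC subrK.
- rewrite !tp_D !tp_d pW tensI_map_mI pb -addrA -(raddfD (cx_d (tensI E))) /=.
  rewrite [mI _ _ + _]addrC subrK -[tensI_d s]/(cx_d (tensI E) s) ds.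
  by rewrite addrC subrK.
Qed.
End PathObject.
End Antiderivative.

(** * Homotopies *)

Section Homotopy.
Variables (k : fieldType) (D : pred mtype).

Lemma eqmor_elementary_homotopy (P Q : modop k D) (f g : mor P Q) :
  eqmor f g -> elementary_homotopy f g.
Proof.
move=> fg; exists (mor_comp (const_mor Q) f).
by split=> u x /=; rewrite evI_mI ?expr0 scale1r // fg.
Qed.

Lemma eqmor_homotopic (P Q : modop k D) (f g : mor P Q) :
  eqmor f g -> homotopic f g.
Proof. by move=> fg; apply/rst_step/eqmor_elementary_homotopy. Qed.

Lemma homotopic_comp (P Q R : modop k D) (p : mor Q R) (f g : mor P Q) :
  homotopic f g -> homotopic (mor_comp p f) (mor_comp p g).
Proof.
elim=> {f g} [f g [h [h0 h1]]|f|f g _ IH|f g h _ IH1 _ IH2].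
- apply: rst_step; exists (mor_comp (tensI_mor p) h).
  by split=> u x; rewrite /= evI_map; congr (p u _); [apply: h0|apply: h1].
- exact: rst_refl.
- exact: rst_sym.
- exact: rst_trans IH1 IH2.
Qed.
End Homotopy.

Section PathObjectMor.
Variables (k : fieldType) (D : pred mtype) (X Y : modop k D) (p : mor X Y).

Lemma eval_natural (c : k) :
  eqmor (mor_comp (eval_op Y c) (tensI_mor p)) (mor_comp p (eval_op X c)).
Proof. by move=> u x; apply: evI_map. Qed.

(** The operad [(Y (x) I) x_(Y x Y) (X x X)], as an iterated pullback. *)
Definition path_boundary : modop k D :=
  pb_op (mor_comp (eval_op Y 1) (pb_fst (eval_op Y 0) p)) p.

Definition path_boundary_mor : mor (tensI_op X) path_boundary :=
  pb_pair (f := mor_comp (eval_op Y 1) (pb_fst (eval_op Y 0) p)) (g := p)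
    (a := pb_pair (eval_natural 0)) (b := eval_op X 1) (eval_natural 1).

Hypothesis char0 : [pchar k] =i pred0.
Hypothesis p_af : forall u, acyclic_fibration (p u).

Lemma path_boundary_acyclic_fibration u :
  acyclic_fibration (path_boundary_mor u).
Proof.
move=> i x y xcyc /pb_homog[/pb_homog[Hi f0i] f1i] dy.
pose H := pb1 (pb1 y); pose f0 := pb2 (pb1 y); pose f1 := pb2 y.
have dH : cx_d _ H = tensI_map (p u) x.
  by rewrite /H -!pb1_d dy !pb1_pair.
have df0 : cx_d _ f0 = evI 0 x.
  by rewrite /f0 -pb2_d -pb1_d dy pb1_pair pb2_pair.
have df1 : cx_d _ f1 = evI 1 x.
  by rewrite /f1 -pb2_d dy pb2_pair.
have H0 : evI 0 H = p u f0 := pb_eq (pb1 y).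
have H1 : evI 1 H = p u f1 := pb_eq y.
have [z zi [dz z0 z1 pz]] :=
  path_object_acyclic_fibration char0 (mor_pr p (u := u))
  (mor_d p (u := u)) (@p_af u) xcyc f0i f1i Hi df0 df1 dH H0 H1.
by exists z => //; split=> //; apply: pbP => //; apply: pbP.
Qed.
End PathObjectMor.

Section AcyclicFibration.
Variables (k : fieldType) (char0 : [pchar k] =i pred0).
Variables (M X Y : modop k predT) (M_min : minimal M) (p : mor X Y).
Hypothesis p_af : forall u, acyclic_fibration (p u).

(** A homotopy between [p f0] and [p f1] is, together with its lifted ends, a
    morphism to [path_boundary p]; a homotopy between [f0] and [f1] is a lift of
    it to the paths in [X]. *)
Lemma elementary_homotopy_lift (f0 f1 : mor M X) :
  elementary_homotopy (mor_comp p f0) (mor_comp p f1) ->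
  elementary_homotopy f0 f1.
Proof.
move=> [H [H0 H1]].
pose b : mor M (path_boundary p) := pb_pair
  (f := mor_comp (eval_op Y 1) (pb_fst (eval_op Y 0) p)) (g := p)
  (a := pb_pair H0) (b := f1) H1.
have [h hE] := lift_minimal char0
  (path_boundary_acyclic_fibration char0 p_af) M_min b.
exists h; split=> u x.
  have e : pb2 (pb1 (b u x)) = f0 u x by rewrite pb1_pair pb2_pair.
  by rewrite -e -hE /= pb1_pair pb2_pair.
have e : pb2 (b u x) = f1 u x by rewrite pb2_pair.
by rewrite -e -hE /= pb2_pair.
Qed.

(** Homotopic morphisms are joined by a zigzag of elementary homotopies. All the
    intermediate morphisms lift strictly to [X], so the zigzag lifts too. *)
Lemma acyclic_fibration_homotopic_inj (f0 f1 : mor M X) :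
  homotopic (mor_comp p f0) (mor_comp p f1) -> homotopic f0 f1.
Proof.
suff H : forall a b : mor M Y, homotopic a b ->
    forall f0 f1 : mor M X, eqmor (mor_comp p f0) a ->
      eqmor (mor_comp p f1) b -> homotopic f0 f1 by move=> /H; apply.
move=> a b; elim=> {a b f0 f1} [a b [h [h0 h1]]|a|a b _ IH|a b c _ IH1 _ IH2];
  move=> f0 f1 f0E f1E.
- apply/rst_step/elementary_homotopy_lift; exists h.
  by split=> u x; rewrite ?h0 ?h1 ?f0E ?f1E.
- apply/rst_step/elementary_homotopy_lift/eqmor_elementary_homotopy => u x.
  by rewrite f0E f1E.
- exact/rst_sym/IH.
- have [f fE] := lift_minimal char0 p_af M_min b.
  exact: rst_trans (IH1 _ _ f0E fE) (IH2 _ _ fE f1E).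
Qed.
End AcyclicFibration.

Definition mor_id (k : fieldType) (D : pred mtype) (P : modop k D) : mor P P.
Proof. by refine (@Mor k D P P (fun u => idfun) _ _ _ _ _). Defined.

(** * The mapping path operad of a weak equivalence *)

Section MappingPath.
Variables (k : fieldType) (D : pred mtype) (Q R : modop k D) (rho : mor Q R).

(** Pairs of a point [q] of [Q] and a path in [R] that starts at [rho q]. *)
Definition mapping_path : modop k D := pb_op rho (eval_op R 0).

Lemma mapping_path_section_eq :
  eqmor (mor_comp rho (mor_id Q))
        (mor_comp (eval_op R 0) (mor_comp (const_mor R) rho)).
Proof. by move=> u x /=; rewrite evI_mI expr0 scale1r. Qed.

Definition mapping_path_section : mor Q mapping_path :=
  pb_pair mapping_path_section_eq.
Definition mapping_path_source : mor mapping_path Q := pb_fst rho (eval_op R 0).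
Definition mapping_path_target : mor mapping_path R :=
  mor_comp (eval_op R 1) (pb_snd rho (eval_op R 0)).

Lemma mapping_path_sourceK :
  eqmor (mor_comp mapping_path_source mapping_path_section) (mor_id Q).
Proof. by []. Qed.

Lemma mapping_path_factor :
  eqmor (mor_comp mapping_path_target mapping_path_section) rho.
Proof. by move=> u x; rewrite /= [LHS]evI_mI expr0 scale1r. Qed.

Hypothesis char0 : [pchar k] =i pred0.

(** This is the base change of [eval0_acyclic_fibration] along [rho]. *)
Lemma mapping_path_source_acyclic u :
  acyclic_fibration (mapping_path_source u).
Proof.
move=> i x q [/pb_homog[_ xi] dx] qi /= dq.
have dx2 : cx_d _ (pb2 x) = 0 := congr1 (fun z : mapping_path u => pb2 z) dx.
have drq : cx_d _ (rho u q) = evI 0 (pb2 x) by rewrite -mor_d dq; apply: pb_eq.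
have [y yi [dy y0]] := eval0_acyclic_fibration char0 (conj xi dx2)
  (mor_homog rho qi) drq.
have e : rho u q = eval_op R 0 u y by [].
exists (mkpb e : pb_cx rho (eval_op R 0) u); first exact/pb_homog.
by split=> //; apply: pbP.
Qed.

Hypothesis rho_we : weak_equivalence rho.

(** Given a cycle [(x1, x2)] and [c] with [d c = x2(1)], the primitive [s] of
    [x2 - x2(0)] shows that [rho x1 = x2(0)] is the boundary of [c - s(1)]. As
    [rho] is injective on homology, [x1 = d q0]; as it is surjective, [q0] can be
    corrected by a cycle [q1] so that [rho q] and [c - s(1)] differ by a
    boundary [d e]. The closed path [d (e t)] from 0 to [d e] then adjusts the
    end of [s + rho q] to [c] without changing its differential. *)
Lemma mapping_path_target_acyclic u :
  acyclic_fibration (mapping_path_target u).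
Proof.
move=> i x c [/pb_homog[x1i x2i] dx] ci /= dc.
have dx1 : cx_d _ (pb1 x) = 0 := congr1 (fun z : mapping_path u => pb1 z) dx.
have dx2 : cx_d _ (pb2 x) = 0 := congr1 (fun z : mapping_path u => pb2 z) dx.
have x20 : rho u (pb1 x) = evI 0 (pb2 x) := pb_eq x.
have {}dc : cx_d _ c = evI 1 (pb2 x) := dc.
have [we_inj _] := rho_we u i; have [_ we_surj] := rho_we u (i + 1).
pose w : tensI (R u) := pb2 x - mI 0 (rho u (pb1 x)).
have wC : cycle i w.
  split; first by apply: homogB => //; apply/mI_homog/mor_homog.
  rewrite (raddfB (cx_d (tensI (R u)))) [X in X - _]dx2 /= tensI_d_mI scale0r.
  rewrite addr0 -mor_d dx1.
  by rewrite !raddf0 addr0.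
have w0 : evI 0 w = 0.
  by rewrite raddfB /= evI_mI expr0 scale1r x20 subrr.
have [s si [ds s0]] := eval0_acyclic_fibration char0 (y := 0) wC (homog0 _ _)
  (etrans (raddf0 _) (esym w0)).
have ds1 : cx_d _ (evI 1 s) = cx_d _ c - rho u (pb1 x).
  by rewrite -evI_d ds raddfB /= evI_mI expr0 scale1r dc.
have [q0 q0i dq0] : homologous i (pb1 x) 0.
  apply: we_inj => //; first by split; [apply: homog0|rewrite raddf0].
  exists (c - evI 1 s); first by apply: homogB => //; apply: evI_homog.
  by rewrite raddf0 subr0 raddfB /= ds1 subKr.
have {}dq0 : cx_d _ q0 = pb1 x by rewrite -dq0 subr0.
have [|q1 [q1i dq1] [e ei de]] := we_surj (rho u q0 - (c - evI 1 s)).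
  split.
    apply: homogB; first exact: mor_homog.
    by apply: homogB => //; apply: evI_homog.
  by rewrite 2!(raddfB (cx_d (R u))) /= ds1 -mor_d dq0 subKr subrr.
pose q := q0 - q1.
pose y : tensI (R u) := s + mI 0 (rho u q) + cx_d _ (mI 1 e : tensI (R u)).
have qi : homog (i + 1) q by apply: homogB.
have dq : cx_d _ q = pb1 x by rewrite raddfB /= dq0 dq1 subr0.
have yi : homog (i + 1) y.
  apply: homogD; last by apply: homog_d; apply: mI_homog.
  by apply: homogD => //; apply/mI_homog/mor_homog.
have dy : cx_d _ y = pb2 x.
  rewrite /y !(raddfD (cx_d (tensI (R u)))) /= (@cx_dd k (tensI (R u))) addr0.
  rewrite ds /=.
  by rewrite tensI_d_mI scale0r addr0 -mor_d dq subrK.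
have y0 : rho u q = eval_op R 0 u y.
  rewrite /= /y !evID evI_d !evI_mI s0 add0r expr0 expr1 scale1r scale0r.
  by rewrite raddf0 addr0.
exists (mkpb y0 : pb_cx rho (eval_op R 0) u); first exact/pb_homog.
split; first exact: pbP.
rewrite -[LHS]/(evI 1 y) /y !evID evI_d !evI_mI !expr1n !scale1r -de raddfB /=.
by rewrite -addrA [X in _ + X]addrA subrK subKr addrC subrK.
Qed.
End MappingPath.

(** * Lifting up to homotopy *)

Section Factorization.
Variables (k : fieldType) (char0 : [pchar k] =i pred0).
Variables (M Q B R : modop k predT) (M_min : minimal M).
Variables (rho : mor Q R) (s : mor Q B) (r : mor B Q) (p : mor B R).
Hypothesis rs : eqmor (mor_comp r s) (mor_id Q).
Hypothesis ps : eqmor (mor_comp p s) rho.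
Hypothesis r_af : forall u, acyclic_fibration (r u).
Hypothesis p_af : forall u, acyclic_fibration (p u).

Let ps_comp (f : mor M Q) :
  homotopic (mor_comp p (mor_comp s f)) (mor_comp rho f).
Proof. by apply: eqmor_homotopic => u x; apply: ps. Qed.

Let rs_comp (f : mor M Q) : homotopic (mor_comp r (mor_comp s f)) f.
Proof. by apply: eqmor_homotopic => u x; apply: rs. Qed.

(** If [g] is a strict lift of [psi] to [B], the candidate is [r g]. Since
    [r s = id], the morphisms [s r g] and [g] have the same image under [r], so
    they are homotopic, and [rho r g = p s r g] is homotopic to [p g = psi]. *)
Lemma homotopy_lift_exists (psi : mor M R) :
  exists psit : mor M Q, homotopic (mor_comp rho psit) psi.
Proof.
have [g gE] := lift_minimal char0 p_af M_min psi.
have sr : homotopic (mor_comp s (mor_comp r g)) g.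
  apply: (acyclic_fibration_homotopic_inj char0 M_min r_af).
  exact: rs_comp.
exists (mor_comp r g).
apply: rst_trans (rst_trans _ _ _ _ _ (homotopic_comp p sr) (eqmor_homotopic gE)).
exact/rst_sym/ps_comp.
Qed.

(** As [rho = p s], a homotopy downstairs lifts through [p] to one between
    [s f0] and [s f1], which [r] brings back to [Q]. *)
Lemma homotopy_lift_unique (f0 f1 : mor M Q) :
  homotopic (mor_comp rho f0) (mor_comp rho f1) -> homotopic f0 f1.
Proof.
move=> h; have sh : homotopic (mor_comp s f0) (mor_comp s f1).
  apply: (acyclic_fibration_homotopic_inj char0 M_min p_af).
  apply: rst_trans (ps_comp f0) _; apply: rst_trans h _.
  exact/rst_sym/ps_comp.
apply: rst_trans (rst_sym _ _ _ _ (rs_comp f0)) _.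
exact: rst_trans (homotopic_comp r sh) (rs_comp f1).
Qed.
End Factorization.

Theorem theorem8p7p2 (k : fieldType) (char0 : [pchar k] =i pred0)
    (M Q R : modop k predT) (rho : mor Q R) (rho_we : weak_equivalence rho)
    (M_min : minimal M) (psi : mor M R) :
  (exists psit : mor M Q, homotopic (mor_comp rho psit) psi) /\
  (forall psit1 psit2 : mor M Q,
     homotopic (mor_comp rho psit1) psi -> homotopic (mor_comp rho psit2) psi ->
     homotopic psit1 psit2).
Proof.
have r_af := @mapping_path_source_acyclic _ _ _ _ rho char0.
have p_af := mapping_path_target_acyclic char0 rho_we.
split=> [|f0 f1 h0 h1].
  exact (homotopy_lift_exists char0 M_min (@mapping_path_sourceK _ _ _ _ rho)
    (@mapping_path_factor _ _ _ _ rho) r_af p_af psi).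
apply: (homotopy_lift_unique char0 M_min (@mapping_path_sourceK _ _ _ _ rho)
  (@mapping_path_factor _ _ _ _ rho) p_af).
exact: rst_trans h0 (rst_sym _ _ _ _ h1).
Qed.
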